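(* Let $I \subseteq A$ and $J \subseteq B$ be nonzero proper ideals. Then for any integer $s \ge 1$, the following two equalities of ideals of $R = A\otimes_{\Bbbk} B$ hold: $${}^{\mathtt m}(I+J)^{(s)} = \sum_{i=0}^s {}^{\mathtt m}I^{(i)}\; {}^{\mathtt m}J^{(s-i)} \qquad\text{and}\qquad {}^{\mathtt a}(I+J)^{(s)} = \sum_{i=0}^s {}^{\mathtt a}I^{(i)}\; {}^{\mathtt a}J^{(s-i)}.$$
   Context: Throughout, $\Bbbk$ is a field, and $A$ and $B$ are Noetherian commutative $\Bbbk$-algebras such that $R = A\otimes_{\Bbbk} B$ is also Noetherian. Ideals of $A$ and of $B$ are identified with their extensions to $R$: for ideals $\mathfrak{a}\subseteq A$ and $\mathfrak{b}\subseteq B$, $\mathfrak{a}+\mathfrak{b}$ means $\mathfrak{a}R+\mathfrak{b}R$ and $\mathfrak{a}\mathfrak{b}$ means $(\mathfrak{a}R)(\mathfrak{b}R)$. For an ideal $\mathfrak{a}$ of a Noetherian commutative ring $S$, $\operatorname{Ass}_S(\mathfrak{a})$ denotes the set of associated primes of $S/\mathfrak{a}$, and $\operatorname{Min}_S(\mathfrak{a})$ the set of minimal primes of $\mathfrak{a}$. For an integer $s\ge 0$, the two notions of $s$-th symbolic power are ${}^{\mathtt m}\mathfrak{a}^{(s)} = \bigcap_{\mathfrak{p}\in \operatorname{Min}_S(\mathfrak{a})} (\mathfrak{a}^sS_{\mathfrak{p}}\cap S)$ and ${}^{\mathtt a}\mathfrak{a}^{(s)} = \bigcap_{\mathfrak{p}\in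 \operatorname{Ass}_S(\mathfrak{a})} (\mathfrak{a}^sS_{\mathfrak{p}}\cap S)$, where $\cap\, S$ means preimage under $S\to S_{\mathfrak{p}}$, and $\mathfrak{a}^0=S$ (so the $0$-th symbolic powers equal $S$). *)

(* Defs.v *)
From HB Require Import structures.
From mathcomp Require Import all_boot all_order all_algebra.
From mathcomp Require Import generic_quotient sesquilinear.
From mathcomp Require Import boolp classical_sets.
From mathcomp Require Import ring.

Set Implicit Arguments.
Unset Strict Implicit.
Unset Printing Implicit Defensive.

Import GRing.Theory.
Local Open Scope quotient_scope.
Local Open Scope classical_set_scope.
Local Open Scope ring_scope.

Section Ideals.
Variable S : comPzRingType.
Implicit Types (I J : set S) (s : nat).

(* The unit ideal [setT] and the zero ideal [[set 0]] are allowed, unlike in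
   the [idealr] structure of [ring_quotient]. *)
Definition is_ideal I : Prop :=
  [/\ I 0, forall x y, I x -> I y -> I (x + y)
    & forall r x, I x -> I (r * x)].

Definition ideal_gen (X : set S) : set S := smallest is_ideal X.

Definition ideal_add I J : set S := [set x + y | x in I & y in J].

Definition ideal_mul I J : set S := ideal_gen [set x * y | x in I & y in J].

Definition ideal_pow I s : set S := iter s (ideal_mul I) setT.

Definition noetherian : Prop :=
  forall I, is_ideal I -> exists gs : seq S, I = ideal_gen [set x | x \in gs].

Definition is_prime (P : set S) : Prop :=
  [/\ is_ideal P, ~ P 1 & forall x y, P (x * y) -> P x \/ P y].

Record prime_ideal := PrimeIdeal {
  prime_set : set S;
  prime_setP : is_prime prime_set }.

(* [[set r | I (r * x)]] is the annihilator of the class of [x] in [S / I]. *)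
Definition Ass I : set prime_ideal :=
  [set p | exists x, prime_set p = [set r | I (r * x)]].

Definition Min I : set prime_ideal :=
  [set p | I `<=` prime_set p /\
    forall q : prime_ideal,
      I `<=` prime_set q -> prime_set q `<=` prime_set p ->
      prime_set q = prime_set p].

End Ideals.

Definition ideal_ext (S T : comPzRingType) (f : {rmorphism S -> T})
  (I : set S) : set T := ideal_gen (f @` I).

(* The localization of [S] at [p]: fractions [a / d] with [d] outside [p],
   where [a / d = b / e] iff [u * (a * e - b * d) = 0] for some [u] outside
   [p] ([S] need not be a domain, so [fraction] does not apply). *)
Section Localization.
Variables (S : comPzRingType) (p : prime_ideal S).

Definition denom := {d : S | ~~ `[< prime_set p d >]}.

Lemma denomP (d : denom) : ~ prime_set p (val d).
Proof. exact/asboolPn/(valP d). Qed.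

Arguments denomP : clear implicits.

Lemma prime_notin1 : ~ prime_set p 1.
Proof. by case: (prime_setP p). Qed.

Lemma prime_notinM x y :
  ~ prime_set p x -> ~ prime_set p y -> ~ prime_set p (x * y).
Proof. by case: (prime_setP p) => _ _ pM px py /pM[]. Qed.

Definition denom_of x (px : ~ prime_set p x) : denom :=
  exist (fun d => ~~ `[< prime_set p d >]) x (introT (asboolPn _) px).

Definition denom1 : denom := denom_of prime_notin1.

Definition denomM (d e : denom) : denom :=
  denom_of (prime_notinM (denomP d) (denomP e)).

Definition frac := (S * denom)%type.
HB.instance Definition _ := Choice.on frac.

Definition eq_frac : rel frac := fun x y =>
  `[< exists2 u, ~ prime_set p u &
        u * (x.1 * val y.2 - y.1 * val x.2) = 0 >].

Lemma eq_fracP x y : reflect (exists2 u, ~ prime_set p u &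
  u * (x.1 * val y.2 - y.1 * val x.2) = 0) (eq_frac x y).
Proof. exact: asboolP. Qed.

Lemma eq_frac_refl : reflexive eq_frac.
Proof.
by move=> x; apply/eq_fracP; exists 1; rewrite ?subrr ?mulr0//; apply: prime_notin1.
Qed.

Lemma eq_frac_sym : symmetric eq_frac.
Proof.
move=> x y; apply/idP/idP => /eq_fracP[u pu h]; apply/eq_fracP; exists u => //;
  by rewrite -opprB mulrN h oppr0.
Qed.

Lemma eq_frac_trans : transitive eq_frac.
Proof.
move=> y x z /eq_fracP[u pu hu] /eq_fracP[v pv hv]; apply/eq_fracP.
exists (u * v * val y.2).
  by apply: prime_notinM (denomP y.2); apply: prime_notinM.
transitivity (v * val z.2 * (u * (x.1 * val y.2 - y.1 * val x.2))
              + u * val x.2 * (v * (y.1 * val z.2 - z.1 * val y.2))).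
  by rewrite /=; ring.
by rewrite hu hv !mulr0 addr0.
Qed.

Canonical eq_frac_equiv :=
  EquivRel eq_frac eq_frac_refl eq_frac_sym eq_frac_trans.

Definition localization := {eq_quot eq_frac}.
HB.instance Definition _ : EqQuotient _ eq_frac localization :=
  EqQuotient.on localization.
HB.instance Definition _ := Choice.on localization.

Definition mk_frac (x : S) (d : denom) : localization := \pi_localization (x, d).

Lemma mk_fracP x d y e :
  (exists2 u, ~ prime_set p u & u * (x * val e - y * val d) = 0) ->
  mk_frac x d = mk_frac y e.
Proof. by move=> h; apply/eqmodP/eq_fracP. Qed.

Lemma mk_frac_eq x d y e : x * val e = y * val d -> mk_frac x d = mk_frac y e.
Proof.
move=> h; apply: mk_fracP; exists 1; first exact: prime_notin1.
by rewrite h subrr mulr0.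
Qed.

Lemma mk_frac_repr (a : localization) : a = mk_frac (repr a).1 (repr a).2.
Proof. by rewrite /mk_frac -surjective_pairing reprK. Qed.

Lemma repr_mk_frac x d : exists2 u, ~ prime_set p u &
  u * ((repr (mk_frac x d)).1 * val d - x * val (repr (mk_frac x d)).2) = 0.
Proof. by apply/(eq_fracP (repr (mk_frac x d)) (x, d))/eqmodP; rewrite reprK. Qed.

Definition loc_opp (a : localization) : localization :=
  mk_frac (- (repr a).1) (repr a).2.

Definition loc_add (a b : localization) : localization :=
  mk_frac ((repr a).1 * val (repr b).2 + (repr b).1 * val (repr a).2)
          (denomM (repr a).2 (repr b).2).

Definition loc_mul (a b : localization) : localization :=
  mk_frac ((repr a).1 * (repr b).1) (denomM (repr a).2 (repr b).2).

Lemma loc_oppE x d : loc_opp (mk_frac x d) = mk_frac (- x) d.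
Proof.
apply: mk_fracP; have [u pu hu] := repr_mk_frac x d.
by exists u => //; rewrite !mulNr -opprD mulrN hu oppr0.
Qed.

Lemma loc_addE x d y e : loc_add (mk_frac x d) (mk_frac y e) =
  mk_frac (x * val e + y * val d) (denomM d e).
Proof.
apply: mk_fracP; move: (repr_mk_frac x d) (repr_mk_frac y e).
case: (repr _) => x' d'; case: (repr _) => y' e' /= [u pu hu] [v pv hv].
exists (u * v); first exact: prime_notinM.
transitivity (v * val e * val e' * (u * (x' * val d - x * val d'))
              + u * val d * val d' * (v * (y' * val e - y * val e'))).
  by rewrite /=; ring.
by rewrite hu hv !mulr0 addr0.
Qed.

Lemma loc_mulE x d y e : loc_mul (mk_frac x d) (mk_frac y e) =
  mk_frac (x * y) (denomM d e).
Proof.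
apply: mk_fracP; move: (repr_mk_frac x d) (repr_mk_frac y e).
case: (repr _) => x' d'; case: (repr _) => y' e' /= [u pu hu] [v pv hv].
exists (u * v); first exact: prime_notinM.
transitivity (v * y' * val e * (u * (x' * val d - x * val d'))
              + u * x * val d' * (v * (y' * val e - y * val e'))).
  by rewrite /=; ring.
by rewrite hu hv !mulr0 addr0.
Qed.

Lemma loc_addA : associative loc_add.
Proof.
move=> a b c; rewrite [a]mk_frac_repr [b]mk_frac_repr [c]mk_frac_repr.
by rewrite !loc_addE; apply: mk_frac_eq => /=; ring.
Qed.

Lemma loc_addC : commutative loc_add.
Proof.
move=> a b; rewrite [a]mk_frac_repr [b]mk_frac_repr.
by rewrite !loc_addE; apply: mk_frac_eq => /=; ring.
Qed.

Lemma loc_add0 : left_id (mk_frac 0 denom1) loc_add.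
Proof.
move=> a; rewrite [a]mk_frac_repr.
by rewrite loc_addE; apply: mk_frac_eq => /=; ring.
Qed.

Lemma loc_addN : left_inverse (mk_frac 0 denom1) loc_opp loc_add.
Proof.
move=> a; rewrite [a]mk_frac_repr.
by rewrite loc_oppE loc_addE; apply: mk_frac_eq => /=; ring.
Qed.

Lemma loc_mulA : associative loc_mul.
Proof.
move=> a b c; rewrite [a]mk_frac_repr [b]mk_frac_repr [c]mk_frac_repr.
by rewrite !loc_mulE; apply: mk_frac_eq => /=; ring.
Qed.

Lemma loc_mulC : commutative loc_mul.
Proof.
move=> a b; rewrite [a]mk_frac_repr [b]mk_frac_repr.
by rewrite !loc_mulE; apply: mk_frac_eq => /=; ring.
Qed.

Lemma loc_mul1 : left_id (mk_frac 1 denom1) loc_mul.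
Proof.
move=> a; rewrite [a]mk_frac_repr.
by rewrite loc_mulE; apply: mk_frac_eq => /=; ring.
Qed.

Lemma loc_mulD : left_distributive loc_mul loc_add.
Proof.
move=> a b c; rewrite [a]mk_frac_repr [b]mk_frac_repr [c]mk_frac_repr.
by rewrite !(loc_addE, loc_mulE); apply: mk_frac_eq => /=; ring.
Qed.

HB.instance Definition _ := GRing.isZmodule.Build localization
  loc_addA loc_addC loc_add0 loc_addN.
HB.instance Definition _ := GRing.Zmodule_isComPzRing.Build localization
  loc_mulA loc_mulC loc_mul1 loc_mulD.

Definition to_loc (x : S) : localization := mk_frac x denom1.

Lemma to_loc_is_zmod_morphism : zmod_morphism to_loc.
Proof.
move=> x y; rewrite -[RHS]/(loc_add _ (loc_opp _)) loc_oppE loc_addE.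
by apply: mk_frac_eq => /=; ring.
Qed.

Lemma to_loc_is_monoid_morphism : monoid_morphism to_loc.
Proof.
split=> // x y; rewrite -[RHS]/(loc_mul _ _) loc_mulE.
by apply: mk_frac_eq => /=; ring.
Qed.

HB.instance Definition _ :=
  GRing.isZmodMorphism.Build S localization to_loc to_loc_is_zmod_morphism.
HB.instance Definition _ :=
  GRing.isMonoidMorphism.Build S localization to_loc to_loc_is_monoid_morphism.

End Localization.

Section SymbolicPowers.
Variable S : comPzRingType.
Implicit Types (I : set S) (s : nat).

Definition symbolic_power (Ps : set (prime_ideal S)) I s : set S :=
  \bigcap_(p in Ps) (to_loc p @^-1` ideal_ext (to_loc p) (ideal_pow I s)).

Definition min_symbolic_power I s : set S := symbolic_power (Min I) I s.

Definition ass_symbolic_power I s : set S := symbolic_power (Ass I) I s.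

End SymbolicPowers.

(* [R], with the algebra morphisms [a |-> a (x) 1] and [b |-> 1 (x) b], is the
   tensor product [A (x)_k B]: the map [(a, b) |-> a (x) b], that is
   [iA a * iB b], is universal among [k]-bilinear maps out of [A * B]; the
   product [(a (x) b) (a' (x) b') = a a' (x) b b'] and the unit [1 (x) 1] are
   then forced by [iA] and [iB] being morphisms of commutative algebras. *)
Definition is_tensor_product (k : fieldType) (A B R : comAlgType k)
    (iA : {lrmorphism A -> R}) (iB : {lrmorphism B -> R}) : Prop :=
  forall (M : lmodType k) (f : {bilinear A -> B -> M}),
    (exists g : {linear R -> M}, forall a b, g (iA a * iB b) = f a b) /\
    (forall g h : {linear R -> M},
       (forall a b, g (iA a * iB b) = f a b) ->
       (forall a b, h (iA a * iB b) = f a b) -> g =1 h).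

(* Main.v *)
Require Import Defs.
From HB Require Import structures.
From mathcomp Require Import all_boot all_order all_algebra.
From mathcomp Require Import sesquilinear boolp classical_sets zify ring.

Set Implicit Arguments.
Unset Strict Implicit.
Unset Printing Implicit Defensive.

Import GRing.Theory.
Local Open Scope classical_set_scope.
Local Open Scope ring_scope.

(** The symbolic power [a^(s)] attached to a family of primes [P] consists of the
    [x] such that [(a^s : x)] lies in no [P]. Write [T I J] for [I R + J R]. As
    everything is flat over [k], colons and intersections can be computed in [A]
    and in [B] separately: [T (I : a) J = (T I J : a)], and [T] commutes with
    arbitrary intersections in each argument. Both facts are read off from a
    description of [T I J] by slices: [z] lies in [T I J] iff [(phi (x) id) z] lies
    in [J] for every linear form [phi] on [A] vanishing on [I]
    ([tensor_ideal_slice]).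

    The right-hand side. Let [F] and [G] be the filtrations of [A] and [B] by the
    symbolic powers of [I] and [J]. By the modular law, and since the intersection
    of [F_i R] and [G_j R] is their product, the sum of the [F_i G_(s-i)] is the
    intersection of the [T F_i G_j] with [i + j = s + 1] and [i, j > 0]
    ([tensor_filtration]). As [(T I J)^s] is contained in each [T I^i J^j], a member
    [x] of the left-hand side lies in the right-hand side once [U := ((T I J)^s : x)]
    is regular modulo all the [T F_i G_j], meaning that no nonzero class is killed by
    all of [U].

    Regularity. By intersecting, it is enough to treat the contractions of [I^i] and
    [J^j] from the local rings at [p] and [q], for [p] and [q] associated (or
    minimal) primes of [I] and [J]. [regular_mod_saturated] reduces this to regularity
    modulo [T p q]. It is a Noetherian induction on a [p]-saturated ideal [N] of [A]:
    either [p] is associated to [N], and one steps up to the saturation of some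
    [N + t A] with [(N : t) = p]; or some [a] in [p] has no power in [N], and [N] is
    the intersection of the saturations of the larger [N + a^n A] by Krull's
    intersection theorem.

    Regularity modulo [T p q]. For associated primes, [p = (I : e)] and
    [q = (J : f)], so that [T p q = (T I J : e f)], and [U] is regular modulo [T I J]
    because it lies in no associated prime. For minimal primes one has to know that
    every associated prime [Q] of [T p q] is a minimal prime of [T I J]: a prime [P]
    between [T I J] and [Q] meets [A] in [p] and [B] in [q], hence contains [T p q],
    and [Q] is minimal over [T p q] because [(A / p) (x) (B / q)] has no embedded
    primes ([tensor_unmixed]). For the latter, an element [u] of [Q] involves finitely
    many elements of [A]; these are algebraic over a polynomial subring [C] of
    [A / p]. The ring [C (x) (B / q)] is a domain whose nonzero elements are regular
    on [(A / p) (x) (B / q)], so [Q] meets it trivially, and incomparability gives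
    that [u] lies in [P].

    The other inclusion amounts to contracting associated (minimal) primes of
    [T I J] to [A] and [B]: [(I^i : x)] is regular modulo [I], hence modulo [T I J],
    in the first case, and minimal primes contract to minimal primes by flatness in
    the second one. *)

(** * Ideals of a commutative ring *)

Section IdealTheory.
Variable S : comPzRingType.
Implicit Types (I J K N X : set S) (s : nat).

Lemma ideal0 I : is_ideal I -> I 0.
Proof. by case. Qed.

Lemma idealD I x y : is_ideal I -> I x -> I y -> I (x + y).
Proof. by case=> _ + _; apply. Qed.

Lemma idealM_l I r x : is_ideal I -> I x -> I (r * x).
Proof. by case=> _ _; apply. Qed.

Lemma idealM_r I r x : is_ideal I -> I x -> I (x * r).
Proof. by move=> hI Ix; rewrite mulrC; apply: idealM_l. Qed.

Lemma idealN I x : is_ideal I -> I x -> I (- x).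
Proof. by move=> hI Ix; rewrite -mulN1r; apply: idealM_l. Qed.

Lemma idealB I x y : is_ideal I -> I x -> I y -> I (x - y).
Proof. by move=> hI Ix Iy; apply: idealD => //; apply: idealN. Qed.

Lemma idealBr I x y : is_ideal I -> I (x - y) -> I y -> I x.
Proof. by move=> hI Ixy Iy; rewrite -[x](subrK y); apply: idealD. Qed.

Lemma idealDr I x y : is_ideal I -> I (x + y) -> I x -> I y.
Proof. by move=> hI Ixy Ix; rewrite -[y](addKr x) addrC; apply: idealB. Qed.

Lemma ideal_sum I (T : Type) (r : seq T) (P : pred T) (F : T -> S) :
  is_ideal I -> (forall i, P i -> I (F i)) -> I (\sum_(i <- r | P i) F i).
Proof.
by move=> hI IF; elim/big_ind: _ => //; [apply: ideal0 | move=> *; apply: idealD].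
Qed.

Lemma ideal1 I x : is_ideal I -> I 1 -> I x.
Proof. by move=> hI I1; rewrite -[x]mulr1; apply: idealM_l. Qed.

Lemma is_idealT : is_ideal (@setT S).
Proof. by split. Qed.

Lemma is_ideal_bigcap (T : Type) (D : set T) (F : T -> set S) :
  (forall i, D i -> is_ideal (F i)) -> is_ideal (\bigcap_(i in D) F i).
Proof.
move=> hF; split=> [i Di|x y Fx Fy i Di|r x Fx i Di].
- exact: ideal0 (hF i Di).
- by apply: idealD (hF i Di) _ _; [apply: Fx | apply: Fy].
- by apply: idealM_l (hF i Di) _; apply: Fx.
Qed.

Lemma is_ideal_gen X : is_ideal (ideal_gen X).
Proof. by apply: is_ideal_bigcap => I []. Qed.

Lemma sub_ideal_gen X : X `<=` ideal_gen X.
Proof. exact: sub_gen_smallest. Qed.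

Lemma ideal_gen_sub X K : is_ideal K -> X `<=` K -> ideal_gen X `<=` K.
Proof. exact: smallest_sub. Qed.

Lemma is_ideal_add I J : is_ideal I -> is_ideal J -> is_ideal (ideal_add I J).
Proof.
move=> hI hJ; split.
- by exists 0; [apply: ideal0 | exists 0; [apply: ideal0 | rewrite addr0]].
- move=> _ _ [a Ia [b Jb <-]] [c Ic [d Jd <-]].
  exists (a + c); first exact: idealD.
  by exists (b + d); [apply: idealD | rewrite addrACA].
- move=> r _ [a Ia [b Jb <-]]; exists (r * a); first exact: idealM_l.
  by exists (r * b); [apply: idealM_l | rewrite mulrDr].
Qed.

Lemma ideal_addl I J : is_ideal J -> I `<=` ideal_add I J.
Proof.
by move=> hJ x Ix; exists x => //; exists 0; [apply: ideal0 | rewrite addr0].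
Qed.

Lemma ideal_addr I J : is_ideal I -> J `<=` ideal_add I J.
Proof.
by move=> hI x Jx; exists 0; [apply: ideal0 | exists x; rewrite ?add0r].
Qed.

Lemma ideal_add_sub I J K :
  is_ideal K -> I `<=` K -> J `<=` K -> ideal_add I J `<=` K.
Proof.
by move=> hK IK JK _ [a Ia [b Jb <-]]; apply: idealD => //; [apply: IK | apply: JK].
Qed.

Lemma ideal_addC I J : ideal_add I J = ideal_add J I.
Proof.
by apply/seteqP; split=> _ [a Ia [b Jb <-]]; exists b => //; exists a; rewrite 1?addrC.
Qed.

Lemma is_ideal_big (r : seq nat) (F : nat -> set S) :
  (forall i, is_ideal (F i)) ->
  is_ideal (\big[@ideal_add S/[set 0]]_(i <- r) F i).
Proof.
move=> hF; elim: r => [|i r IH]; last by rewrite big_cons; apply: is_ideal_add.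
rewrite big_nil; split=> [//|x y -> ->|t x ->].
  by rewrite addr0.
by rewrite mulr0.
Qed.

Lemma ideal_big_sup (r : seq nat) (F : nat -> set S) i :
  (forall j, is_ideal (F j)) -> i \in r ->
  F i `<=` \big[@ideal_add S/[set 0]]_(j <- r) F j.
Proof.
move=> hF; elim: r => // j r IH; rewrite in_cons big_cons => /predU1P[->|ir].
  exact/ideal_addl/is_ideal_big.
by apply: subset_trans (IH ir) _; apply: ideal_addr.
Qed.

Lemma ideal_big_sub (r : seq nat) (F : nat -> set S) K : is_ideal K ->
  (forall i, i \in r -> F i `<=` K) ->
  \big[@ideal_add S/[set 0]]_(i <- r) F i `<=` K.
Proof.
move=> hK; elim: r => [|j r IH] FK.
  by rewrite big_nil => x ->; apply: ideal0.
rewrite big_cons; apply: ideal_add_sub => //; first exact/FK/mem_head.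
by apply: IH => i ir; apply: FK; rewrite in_cons ir orbT.
Qed.

(** The colon ideal [(N : x)]. *)
Definition colon N x : set S := [set r | N (r * x)].

Lemma is_ideal_colon N x : is_ideal N -> is_ideal (colon N x).
Proof.
move=> hN; split=> [|a b|r a]; rewrite /colon /= ?mul0r.
- exact: ideal0.
- by rewrite mulrDl; apply: idealD.
- by rewrite -mulrA; apply: idealM_l.
Qed.

(** The ideal [I + a S]. *)
Definition ideal_adjoin I a : set S := [set y | exists r, I (y - r * a)].

Lemma is_ideal_adjoin I a : is_ideal I -> is_ideal (ideal_adjoin I a).
Proof.
move=> hI; split=> [|x y [r Ix] [s Iy]|t x [r Ix]].
- by exists 0; rewrite mul0r subr0; apply: ideal0.
- by exists (r + s); rewrite mulrDl opprD addrACA; apply: idealD.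
- by exists (t * r); rewrite -mulrA -mulrBr; apply: idealM_l.
Qed.

Lemma sub_ideal_adjoin I a : I `<=` ideal_adjoin I a.
Proof. by move=> x Ix; exists 0; rewrite mul0r subr0. Qed.

Lemma mem_ideal_adjoin I a : is_ideal I -> ideal_adjoin I a a.
Proof. by move=> hI; exists 1; rewrite mul1r subrr; apply: ideal0. Qed.

Lemma ideal_adjoin_sub I a K :
  is_ideal K -> I `<=` K -> K a -> ideal_adjoin I a `<=` K.
Proof.
move=> hK IK Ka x [r Ix]; rewrite -[x](subrK (r * a)).
by apply: idealD => //; [apply: IK | apply: idealM_l].
Qed.

Lemma is_ideal_mul I J : is_ideal (ideal_mul I J).
Proof. exact: is_ideal_gen. Qed.

Lemma ideal_mulM I J x y : I x -> J y -> ideal_mul I J (x * y).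
Proof. by move=> Ix Jy; apply: sub_ideal_gen; exists x => //; exists y. Qed.

Lemma ideal_mul_sub I J K : is_ideal K ->
  (forall x y, I x -> J y -> K (x * y)) -> ideal_mul I J `<=` K.
Proof.
move=> hK IJK; apply: ideal_gen_sub => // _ [x Ix [y Jy <-]]; exact: IJK.
Qed.

Lemma is_ideal_pow I s : is_ideal (ideal_pow I s).
Proof. by case: s => [|s]; [apply: is_idealT | apply: is_ideal_mul]. Qed.

Lemma ideal_pow_subS I s : ideal_pow I s.+1 `<=` ideal_pow I s.
Proof.
by apply: ideal_mul_sub => [|x y _]; [|apply: idealM_l]; apply: is_ideal_pow.
Qed.

Lemma ideal_powD I m n x y :
  ideal_pow I m x -> ideal_pow I n y -> ideal_pow I (m + n) (x * y).
Proof.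
elim: m x => [|m IH] x Ix Iy.
  by apply: idealM_l Iy; apply: is_ideal_pow.
suff sub : ideal_pow I m.+1 `<=` colon (ideal_pow I (m.+1 + n)) y by exact: sub.
apply: ideal_mul_sub => [|a b Ia Ib]; first exact/is_ideal_colon/is_ideal_pow.
by rewrite /colon /= -mulrA; apply: ideal_mulM => //; apply: IH.
Qed.

(** [regular_mod U N]: no nonzero element of [S / N] is killed by all of [U],
    i.e. [(N : U) = N].  Allowing a set [U] instead of a single element makes
    prime avoidance unnecessary. *)
Definition regular_mod (U N : set S) :=
  forall z, (forall u, U u -> N (u * z)) -> N z.

Lemma regular_mod_colon U N x :
  regular_mod U N -> regular_mod U (colon N x).
Proof. by move=> reg z Uz; apply: reg => u /Uz; rewrite /colon /= mulrA. Qed.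

Lemma prime_setI (P : prime_ideal S) : is_ideal (prime_set P).
Proof. by case: (prime_setP P). Qed.

Lemma prime_setM (P : prime_ideal S) x y :
  prime_set P (x * y) -> prime_set P x \/ prime_set P y.
Proof. by case: (prime_setP P) => _ _; apply. Qed.

Lemma prime_setN1 (P : prime_ideal S) : ~ prime_set P 1.
Proof. by case: (prime_setP P). Qed.

Lemma prime_notX (P : prime_ideal S) x n :
  ~ prime_set P x -> ~ prime_set P (x ^+ n).
Proof.
move=> Px; elim: n => [|n IH]; first exact: prime_setN1.
by rewrite exprS => /prime_setM[].
Qed.

End IdealTheory.

Lemma is_ideal_ext (S T : comPzRingType) (f : {rmorphism S -> T}) I :
  is_ideal (ideal_ext f I).
Proof. exact: is_ideal_gen. Qed.

Lemma ideal_extM (S T : comPzRingType) (f : {rmorphism S -> T}) (I : set S) x :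
  I x -> ideal_ext f I (f x).
Proof. by move=> Ix; apply: sub_ideal_gen; exists x. Qed.

Lemma ideal_ext_sub (S T : comPzRingType) (f : {rmorphism S -> T}) I K :
  is_ideal K -> (forall x, I x -> K (f x)) -> ideal_ext f I `<=` K.
Proof. by move=> hK IK; apply: ideal_gen_sub => // _ [x Ix <-]; apply: IK. Qed.

Lemma is_ideal_preim (S T : comPzRingType) (f : {rmorphism S -> T}) K :
  is_ideal K -> is_ideal (f @^-1` K).
Proof.
move=> hK; split=> [|x y|r x]; rewrite /= ?rmorph0 ?rmorphD ?rmorphM.
- exact: ideal0.
- exact: idealD.
- exact: idealM_l.
Qed.

Lemma is_prime_preim (S T : comPzRingType) (f : {rmorphism S -> T})
  (P : prime_ideal T) : is_prime (f @^-1` prime_set P).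
Proof.
split; first exact/is_ideal_preim/prime_setI.
  by rewrite /= rmorph1; apply: prime_setN1.
by move=> x y; rewrite /= rmorphM => /prime_setM.
Qed.

Lemma ideal_pow_rmorph (S T : comPzRingType) (f : {rmorphism S -> T}) I K s :
  (forall x, I x -> K (f x)) ->
  forall x, ideal_pow I s x -> ideal_pow K s (f x).
Proof.
move=> IK; elim: s => [|s IH] x //.
suff sub : ideal_pow I s.+1 `<=` f @^-1` ideal_pow K s.+1 by exact: sub.
apply: ideal_mul_sub; first exact/is_ideal_preim/is_ideal_pow.
by move=> a b Ia Ib; rewrite /= rmorphM; apply: ideal_mulM; [apply: IK | apply: IH].
Qed.

(** * Symbolic powers without localizations *)

Section Symbolic.
Variable S : comPzRingType.
Implicit Types (I N : set S) (s : nat).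

(** The contraction of the extension of [N] to the local ring at [P]. *)
Lemma to_loc_ext (P : prime_ideal S) N x : is_ideal N ->
  ideal_ext (to_loc P) N (to_loc P x) <-> exists2 u, ~ prime_set P u & N (u * x).
Proof.
move=> hN; split=> [|[u Pu Nux]]; last first.
  have -> : to_loc P x = mk_frac 1 (denom_of Pu) * to_loc P (u * x).
    rewrite -[RHS]/(loc_mul _ _) loc_mulE; apply: mk_frac_eq => /=; ring.
  apply: (idealM_l _ (is_ideal_ext _ _)).
  by apply: sub_ideal_gen; exists (u * x).
have sub : ideal_ext (to_loc P) N `<=`
    [set y | exists a d, N a /\ y = mk_frac (p := P) a d].
  apply: ideal_gen_sub => [|_ [a Na <-]]; last by exists a, (denom1 P).
  split=> [|_ _ [a [d [Na ->]]] [b [e [Nb ->]]]|r _ [a [d [Na ->]]]].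
  - by exists 0, (denom1 P); split=> //; apply: ideal0.
  - exists (a * val e + b * val d), (denomM d e); split.
      by apply: idealD => //; apply: idealM_r.
    by rewrite -[LHS]/(loc_add _ _) loc_addE.
  - exists ((repr r).1 * a), (denomM (repr r).2 d); split; first exact: idealM_l.
    by rewrite [r in LHS]mk_frac_repr -[LHS]/(loc_mul _ _) loc_mulE.
move=> /sub[a [d [Na]]] /eqmodP/eq_fracP[u Pu uE].
exists (u * val d).
  by apply: prime_notinM => //; apply: denomP.
have -> : u * val d * x = u * a; last exact: idealM_l.
rewrite -mulrA [val d * x]mulrC -[a]mulr1.
by apply/eqP; rewrite -subr_eq0 -mulrBr; apply/eqP.
Qed.

Lemma symbolic_powerP (Ps : set (prime_ideal S)) I s x :
  symbolic_power Ps I s x <->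
  forall P, Ps P -> exists2 u, ~ prime_set P u & ideal_pow I s (u * x).
Proof.
by split=> H P PsP; apply/to_loc_ext; by [apply: is_ideal_pow | apply: H].
Qed.

(** The contraction to [S] of the extension of [N] to the local ring at [P]. *)
Definition saturation (P : prime_ideal S) N : set S :=
  [set x | exists2 u, ~ prime_set P u & N (u * x)].

(** [N] is contracted from the local ring at [P]. *)
Definition saturated (P : prime_ideal S) N :=
  forall u x, ~ prime_set P u -> N (u * x) -> N x.

Lemma symbolic_power_bigcap (Ps : set (prime_ideal S)) I s :
  symbolic_power Ps I s = \bigcap_(P in Ps) saturation P (ideal_pow I s).
Proof. by apply/seteqP; split=> x /symbolic_powerP. Qed.

Lemma is_ideal_saturation P N : is_ideal N -> is_ideal (saturation P N).
Proof.
move=> hN; split=> [|x y [u Pu Nx] [v Pv Ny]|r x [u Pu Nx]].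
- by exists 1; [apply: prime_setN1 | rewrite mulr0; apply: ideal0].
- exists (u * v); first exact: prime_notinM.
  rewrite mulrDr; apply: idealD => //; last by rewrite -mulrA; apply: idealM_l.
  by rewrite mulrAC; apply: idealM_r.
- by exists u => //; rewrite mulrCA; apply: idealM_l.
Qed.

Lemma sub_saturation P N : N `<=` saturation P N.
Proof. by move=> x Nx; exists 1; [apply: prime_setN1 | rewrite mul1r]. Qed.

Lemma saturated_saturation P N : saturated P (saturation P N).
Proof.
move=> u x Pu [v Pv Nx]; exists (v * u); first exact: prime_notinM.
by rewrite -mulrA.
Qed.

Lemma saturation_sub P N N' :
  saturated P N' -> N `<=` N' -> saturation P N `<=` N'.
Proof. by move=> satN' NN' x [u Pu /NN'/satN']; apply. Qed.

Lemma saturated_colon P N x : saturated P N -> saturated P (colon N x).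
Proof. by move=> satN u y Pu; rewrite /colon /= -mulrA => /satN; apply. Qed.

Lemma is_ideal_symbolic Ps I s : is_ideal (symbolic_power Ps I s).
Proof.
rewrite symbolic_power_bigcap; apply: is_ideal_bigcap => P _.
exact/is_ideal_saturation/is_ideal_pow.
Qed.

Lemma symbolic_subS Ps I s :
  symbolic_power Ps I s.+1 `<=` symbolic_power Ps I s.
Proof.
move=> x /symbolic_powerP Ix; apply/symbolic_powerP => P /Ix[u Pu Iux].
by exists u => //; apply: ideal_pow_subS.
Qed.

Lemma pow_sub_symbolic Ps I s : ideal_pow I s `<=` symbolic_power Ps I s.
Proof.
move=> x Ix; apply/symbolic_powerP => P _; exists 1; first exact: prime_setN1.
by rewrite mul1r.
Qed.

Lemma symbolic_power0 Ps I : symbolic_power Ps I 0 = setT.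
Proof. by rewrite -subTset; apply: (@pow_sub_symbolic Ps I 0). Qed.

End Symbolic.

(** * Noetherian rings *)

Section Noetherian.
Variable S : comPzRingType.
Hypothesis noethS : noetherian S.
Implicit Types (I J N K : set S) (P : prime_ideal S).

(** The union of a chain of ideals is finitely generated, hence a member. *)
Lemma noetherian_chain (F : set (set S)) : F !=set0 ->
  (forall I, F I -> is_ideal I) -> total_on F subset ->
  exists2 I, F I & \bigcup_(J in F) J = I.
Proof.
move=> [I0 FI0] hF totF; set U := \bigcup_(J in F) J.
have hU : is_ideal U.
  split=> [|x y [I FI Ix] [J FJ Jy]|r x [I FI Ix]].
  - by exists I0 => //; apply: ideal0; apply: hF.
  - have [IJ|JI] := totF _ _ FI FJ.
      by exists J => //; apply: idealD => //; [apply: hF | apply: IJ].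
    by exists I => //; apply: idealD => //; [apply: hF | apply: JI].
  - by exists I => //; apply: idealM_l => //; apply: hF.
have [gs Ugs] := noethS hU.
have [I FI gsI] : exists2 I, F I & forall g, g \in gs -> I g.
  have gsU g : g \in gs -> U g by move=> ggs; rewrite Ugs; apply: sub_ideal_gen.
  elim: gs gsU {Ugs} => [|g gs IH] gsU; first by exists I0.
  have [h hgs|I FI gsI] := IH; first by apply: gsU; rewrite in_cons hgs orbT.
  have [J FJ Jg] := gsU g (mem_head _ _).
  have [IJ|JI] := totF _ _ FI FJ.
    by exists J => // h; rewrite in_cons => /predU1P[->//|/gsI/IJ].
  by exists I => // h; rewrite in_cons => /predU1P[->|/gsI//]; apply: JI.
exists I => //; apply/seteqP; split; last by move=> x Ix; exists I.
by rewrite Ugs; apply: ideal_gen_sub => //; apply: hF.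
Qed.

Lemma noetherian_ind (C : set S -> Prop) :
  (forall I, is_ideal I ->
     (forall J, is_ideal J -> I `<=` J -> ~ J `<=` I -> C J) -> C I) ->
  forall I, is_ideal I -> C I.
Proof.
move=> ind I hI; apply: contrapT => nCI.
(* The empty set is thrown in to make empty chains bounded. *)
pose D := [set J : set S | J = set0 \/ (is_ideal J /\ ~ C J)].
have [F FD totF|J [[J0|[hJ nCJ]] maxJ]] := @Zorn_bigcup S D.
- have [[J [FJ [hJ nCJ]]]|nF] := pselect (exists J, F J /\ is_ideal J /\ ~ C J).
    pose G := F `&` [set J | is_ideal J].
    have [|K []//|K L [FK _] [FL _]|K [FK hK] GK] := @noetherian_chain G.
    + by exists J.
    + exact: totF.
    have -> : \bigcup_(X in F) X = K.
      rewrite -GK; apply/seteqP; split=> x [L FL Lx]; last by exists L => //; case: FL.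
      case: (FD L FL) => [L0|[hL _]]; first by rewrite L0 in Lx.
      by exists L.
    exact: FD.
  left; rewrite -subset0 => x [J FJ Jx].
  case: (FD J FJ) => [J0|[hJ nCJ]]; first by rewrite J0 in Jx.
  by apply: nF; exists J.
- apply: (maxJ I); last by right.
  by rewrite J0; split=> // /(_ 0 (ideal0 hI)).
- apply: nCJ; apply: ind => // K hK JK nKJ.
  by apply: contrapT => nCK; apply: (maxJ K) => //; right.
Qed.

Lemma noetherian_seq (F : nat -> set S) :
  (forall n, is_ideal (F n)) -> (forall n, F n `<=` F n.+1) ->
  exists n, forall m, F m `<=` F n.
Proof.
move=> hF incF.
have monoF m n : (m <= n)%N -> F m `<=` F n.
  by elim: n => [|n IH]; rewrite leq_eqVlt => /predU1P[->//|//];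
    rewrite ltnS => /IH mn x /mn/incF.
have [| | |I [n _ <-] FE] := @noetherian_chain (range F).
- by exists (F 0%N), 0%N.
- by move=> _ [n _ <-].
- move=> _ _ [m _ <-] [n _ <-].
  by case/orP: (leq_total m n) => /monoF; [left | right].
- by exists n => m x Fmx; rewrite -FE; exists (F m) => //; exists m.
Qed.

(** A maximal element among the proper ideals [(N : t * z)] is prime; being a colon
    ideal, it is associated to [N]. *)
Lemma prime_above_colon N z : is_ideal N -> ~ N z ->
  exists (P : prime_ideal S) t,
    prime_set P = colon N (t * z) /\ colon N z `<=` prime_set P.
Proof.
move=> hN Nz.
pose C K := forall z, ~ N z -> colon N z = K -> exists (P : prime_ideal S) t,
  prime_set P = colon N (t * z) /\ colon N z `<=` prime_set P.
suff : C (colon N z) by apply.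
apply: noetherian_ind; last exact: is_ideal_colon.
move=> I _ IH {}z {}Nz IE; subst I.
have [prz|nprz] := pselect (is_prime (colon N z)).
  by exists (PrimeIdeal prz), 1; split=> //=; rewrite mul1r.
have [x [y [Nxy [Nx Ny]]]] : exists x y,
    colon N z (x * y) /\ ~ colon N z x /\ ~ colon N z y.
  apply: contrapT => nex; apply: nprz; split; first exact: is_ideal_colon.
    by rewrite /colon /= mul1r.
  move=> x y Nxy; apply: contrapT => /not_orP[Nx Ny]; apply: nex; by exists x, y.
have sub : colon N z `<=` colon N (y * z).
  by move=> r Nrz; rewrite /colon /= mulrCA; apply: idealM_l.
have [||||P [t [PE subP]]] := IH (colon N (y * z)) _ _ _ (y * z) _ erefl => //.
- exact: is_ideal_colon.
- by move=> /(_ x) subx; apply: Nx; apply: subx; rewrite /colon /= mulrA.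
- exists P, (t * y); split; last exact: subset_trans subP.
  by rewrite -mulrA.
Qed.

Lemma Ass_above_colon N z : is_ideal N -> ~ N z ->
  exists2 P, Ass N P & colon N z `<=` prime_set P.
Proof.
by move=> hN /(prime_above_colon hN)[P [t [PE sub]]]; exists P => //; exists (t * z).
Qed.

Lemma regular_mod_Ass N (U : set S) : is_ideal N ->
  (forall P, Ass N P -> ~ U `<=` prime_set P) -> regular_mod U N.
Proof.
move=> hN NU z Uz; apply: contrapT => /(Ass_above_colon hN)[P AP sub].
by apply: (NU P AP) => u /Uz; apply: sub.
Qed.

(** An ideal disjoint from a multiplicative set [W] lies in a prime ideal disjoint
    from [W]. *)
Lemma prime_avoiding N (W : set S) : is_ideal N -> W 1 ->
  (forall x y, W x -> W y -> W (x * y)) -> (forall x, N x -> ~ W x) ->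
  exists2 P : prime_ideal S, N `<=` prime_set P & forall x, prime_set P x -> ~ W x.
Proof.
move=> hN W1 WM; move: N hN.
apply: noetherian_ind => I hI IH NW.
have [prI|nprI] := pselect (is_prime I); first by exists (PrimeIdeal prI).
have [x [y [Ixy [Ix Iy]]]] : exists x y, I (x * y) /\ ~ I x /\ ~ I y.
  apply: contrapT => nex; apply: nprI; split=> //; first by move/NW.
  move=> x y Ixy; apply: contrapT => /not_orP[Ix Iy]; apply: nex; by exists x, y.
have step a : ~ I a -> (exists2 w, W w & ideal_adjoin I a w) \/
    exists2 P : prime_ideal S, I `<=` prime_set P & forall x, prime_set P x -> ~ W x.
  move=> Ia; have [|nW] := pselect (exists2 w, W w & ideal_adjoin I a w); first by left.
  right; have [||||P sP PW] := IH (ideal_adjoin I a) => //.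
  - exact: is_ideal_adjoin.
  - exact: sub_ideal_adjoin.
  - by move=> /(_ a) ga; apply/Ia/ga; apply: mem_ideal_adjoin.
  - by move=> b gb Wb; apply: nW; exists b.
  - by exists P => //; apply: subset_trans sP; apply: sub_ideal_adjoin.
have [[w Ww [r Ir]]|] := step x Ix; last by [].
have [[v Wv [s Is]]|] := step y Iy; last by [].
have [] := NW (w * v); last exact: WM.
have -> : w * v = v * (w - r * x) + (r * x) * (v - s * y) + (r * s) * (x * y).
  by ring.
by do ?[apply: idealD => //]; apply: idealM_l.
Qed.

(** Krull's intersection theorem for the powers of one element. *)
Lemma krull_principal N P a y : is_ideal N -> saturated P N -> prime_set P a ->
  (forall n, saturation P (ideal_adjoin N (a ^+ n)) y) -> N y.
Proof.
move=> hN satN Pa satNy.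
have /choice[f fP] n : exists wz : S * S,
    ~ prime_set P wz.1 /\ N (wz.1 * y - wz.2 * a ^+ n).
  by have [w Pw [z Nz]] := satNy n; exists (w, z).
(* Modulo N, w_n y = z_n a^n; the point is that some z_n is killed by a^n. *)
pose w n := (f n).1; pose z n := (f n).2.
have Pw n : ~ prime_set P (w n) by case: (fP n).
have Nz n : N (w n * y - z n * a ^+ n) by case: (fP n).
have [n0 n0P] : exists n, forall m, colon N (a ^+ m) `<=` colon N (a ^+ n).
  apply: noetherian_seq => n; first exact: is_ideal_colon.
  by move=> x Nx; rewrite /colon /= exprS mulrCA; apply: idealM_l.
set C := colon N (a ^+ n0) in n0P.
have hC : is_ideal C by apply: is_ideal_colon.
have satC : saturated P C by apply: saturated_colon.
have rel n : C (w n.+1 * z n - w n * a * z n.+1).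
  apply: (n0P n); rewrite /colon /=.
  have -> : (w n.+1 * z n - w n * a * z n.+1) * a ^+ n =
      w n * (w n.+1 * y - z n.+1 * a ^+ n.+1) - w n.+1 * (w n * y - z n * a ^+ n).
    by rewrite exprS; ring.
  by apply: idealB => //; apply: idealM_l.
(* The relations w_(n+1) z_n = w_n a z_(n+1) modulo C make G increase; once it is
   stationary, z_n times a unit at P is a multiple of a z_n modulo C. *)
pose G n := saturation P (ideal_adjoin C (z n)).
have hG n : is_ideal (G n) by apply: is_ideal_saturation; apply: is_ideal_adjoin.
have incG n : G n `<=` G n.+1.
  apply: saturation_sub; first exact: saturated_saturation.
  apply: ideal_adjoin_sub => //.
    by apply: subset_trans (@sub_saturation _ _ _); apply: sub_ideal_adjoin.
  by exists (w n.+1) => //; exists (w n * a).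
have [n1 n1P] := noetherian_seq hG incG.
have incGn m n : G m `<=` G (m + n)%N.
  elim: n => [|n IH]; first by rewrite addn0.
  by rewrite addnS; apply: subset_trans IH (incG _).
pose n := (n1 + n0)%N.
have [u Pu [r Cr]] : G n (z n.+1).
  apply/incGn/(n1P n.+1); exists 1; first exact: prime_setN1.
  by rewrite mul1r; apply: mem_ideal_adjoin.
pose d := u * w n.+1 - w n * a * r.
have Pd : ~ prime_set P d.
  move=> Pd; have [//|/Pw//] : prime_set P u \/ prime_set P (w n.+1).
  apply: prime_setM; apply: idealBr (prime_setI P) Pd _.
  by rewrite mulrAC; apply: idealM_l => //; apply: prime_setI.
have Cd : C (d * z n).
  have -> : d * z n =
      u * (w n.+1 * z n - w n * a * z n.+1) + w n * a * (u * z n.+1 - r * z n).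
    by rewrite /d; ring.
  by apply: idealD => //; apply: idealM_l.
have Cz : C (z n) := satC _ _ Pd Cd.
apply: (satN (w n)) => //; apply: idealBr (Nz n) _ => //.
by rewrite exprD mulrCA; apply: idealM_l.
Qed.

(** The ideal generated by [N] in the local ring at a minimal prime of [N] contains
    a power of every element of the maximal ideal. *)
Lemma Min_nilpotent N P x : is_ideal N -> Min N P -> prime_set P x ->
  exists w n, ~ prime_set P w /\ N (w * x ^+ n).
Proof.
move=> hN [NP minP] Px; apply: contrapT => nex.
pose W := [set y | exists w n, ~ prime_set P w /\ y = w * x ^+ n].
have [||y Ny [w [n [Pw yE]]]|Q NQ QW] := @prime_avoiding N W hN.
- by exists 1, 0%N; rewrite mulr1; split=> //; apply: prime_setN1.
- move=> _ _ [v [m [Pv ->]]] [w [n [Pw ->]]]; exists (v * w), (m + n)%N.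
  by split; [apply: prime_notinM | rewrite exprD mulrACA].
- by apply: nex; exists w, n; rewrite -yE.
have QP : prime_set Q `<=` prime_set P.
  move=> y Qy; apply: contrapT => Py; apply: (QW y Qy).
  by exists y, 0%N; rewrite mulr1.
apply: (QW x); first by rewrite (minP Q).
by exists 1, 1%N; rewrite mul1r; split=> //; apply: prime_setN1.
Qed.

End Noetherian.

(** * Linear functionals and tensor products *)

Section Functionals.
Variables (k : fieldType) (M : lmodType k).

Definition is_subspace (V : set M) :=
  V 0 /\ forall c x y, V x -> V y -> V (c *: x + y).

Lemma subspaceZ (V : set M) c x : is_subspace V -> V x -> V (c *: x).
Proof. by move=> [V0 VP] Vx; rewrite -[c *: x]addr0; apply: VP. Qed.

Lemma subspaceD (V : set M) x y : is_subspace V -> V x -> V y -> V (x + y).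
Proof. by move=> [V0 VP] Vx Vy; rewrite -[x]scale1r; apply: VP. Qed.

Lemma subspaceB (V : set M) x y : is_subspace V -> V x -> V y -> V (x - y).
Proof.
by move=> hV Vx Vy; rewrite -scaleN1r; apply: subspaceD => //; apply: subspaceZ.
Qed.

Lemma separating_functional (V : set M) a : is_subspace V -> ~ V a ->
  exists phi : {linear M -> k^o}, (forall x, V x -> phi x = 0) /\ phi a = 1.
Proof.
move=> hV Va.
(* The empty set is thrown in to make empty chains bounded. *)
pose D := [set W : set M | W = set0 \/ [/\ is_subspace W, V `<=` W & ~ W a]].
have [F FD totF|H [HD maxH]] := @Zorn_bigcup M D.
  have [[W [FW hW]]|nF] := pselect (exists W, F W /\ W !=set0); last first.
    left; rewrite -subset0 => x [W FW Wx]; apply: nF; exists W; split=> //.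
    by exists x.
  have FE X x : F X -> X x -> [/\ is_subspace X, V `<=` X & ~ X a].
    by move=> /FD[->|].
  have [x0 Wx0] := hW; have [[W0 WP] VW Wa] := FE _ _ FW Wx0.
  right; split; last by move=> [X FX Xa]; have [] := FE X a FX Xa.
    split; first by exists W.
    move=> c x y [X FX Xx] [Y FY Yy].
    have [XY|YX] := totF _ _ FX FY.
      exists Y => //; have [[_ YP] _ _] := FE Y y FY Yy.
      by apply: YP => //; apply: XY.
    exists X => //; have [[_ XP] _ _] := FE X x FX Xx.
    by apply: XP => //; apply: YX.
  by move=> x Vx; exists W => //; apply: VW.
have [hH VH Ha] : [/\ is_subspace H, V `<=` H & ~ H a].
  case: HD => // H0; case: (maxH V); last by right; split.
  by rewrite H0; split=> // /(_ 0); case: hV => V0 _ /(_ V0).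
have H0 : H 0 by case: hH.
have ex x : exists c, H (x - c *: a).
  have [Hx|Hx] := pselect (H x); first by exists 0; rewrite scale0r subr0.
  pose K := [set y | exists2 h, H h & exists c, y = h + c *: x].
  have [[h Hh [c aE]]|Ka] := pselect (K a); last first.
    case: (maxH K).
      split; first by move=> h Hh; exists h => //; exists 0; rewrite scale0r addr0.
      by move=> /(_ x) Kx; apply/Hx/Kx; exists 0 => //; exists 1; rewrite scale1r add0r.
    right; split=> //.
      split; first by exists 0 => //; exists 0; rewrite scale0r addr0.
      move=> c _ _ [h Hh [d ->]] [g Hg [e ->]]; exists (c *: h + g).
        by case: hH => _; apply.
      by exists (c * d + e); rewrite scalerDr scalerDl scalerA addrACA.
    by move=> y /VH Hy; exists y => //; exists 0; rewrite scale0r addr0.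
  have [c0|c0] := eqVneq c 0.
    by case: Ha; rewrite aE c0 scale0r addr0.
  exists c^-1; rewrite aE scalerDr scalerA mulVf// scale1r opprD addrCA subrr addr0.
  by rewrite -scalerN -scaleN1r; do 2![apply: subspaceZ => //].
have uniq x c d : H (x - c *: a) -> H (x - d *: a) -> c = d.
  move=> Hc Hd; apply/eqP; rewrite -subr_eq0; apply/negP => /negP cd0.
  apply: Ha; rewrite -[a]scale1r -(mulVf cd0) -scalerA; apply: subspaceZ => //.
  have -> : (c - d) *: a = (x - d *: a) - (x - c *: a).
    by rewrite scalerBl opprB [RHS]addrC addrA subrK.
  exact: subspaceB.
pose f x : k^o := projT1 (cid (ex x)).
have fP x : H (x - f x *: a) by rewrite /f; case: cid.
have fE x c : H (x - c *: a) -> f x = c by apply: uniq; apply: fP.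
have flin : linear f.
  move=> c x y; apply: fE; rewrite scalerDl opprD addrACA -scalerA -scalerBr.
  by case: hH => _; apply; apply: fP.
pose phi : {linear M -> k^o} := HB.pack f (GRing.isLinear.Build _ _ _ _ f flin).
exists phi; split=> [x Vx|]; apply: fE; last by rewrite scale1r subrr.
by rewrite scale0r subr0; apply: VH.
Qed.

End Functionals.

(** [tensor_ideal iA iB I J] is [I R + J R], the kernel of
    [R -> (A / I) (x) (B / J)]. *)
Definition tensor_ideal (k : fieldType) (A B R : comAlgType k)
    (iA : {lrmorphism A -> R}) (iB : {lrmorphism B -> R}) (I : set A) (J : set B)
  : set R := ideal_add (ideal_ext iA I) (ideal_ext iB J).

Lemma tensor_idealC (k : fieldType) (A B R : comAlgType k)
    (iA : {lrmorphism A -> R}) (iB : {lrmorphism B -> R}) I J :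
  tensor_ideal iA iB I J = tensor_ideal iB iA J I.
Proof. exact: ideal_addC. Qed.

Lemma tensor_productC (k : fieldType) (A B R : comAlgType k)
    (iA : {lrmorphism A -> R}) (iB : {lrmorphism B -> R}) :
  is_tensor_product iA iB -> is_tensor_product iB iA.
Proof.
move=> tensorR M f.
pose f' a b := f b a.
have f'P : bilinear_for *:%R *:%R f'.
  split=> [b|a] c x y; rewrite /f'; first exact: linearPr.
  exact: linearPl.
pose F : {bilinear A -> B -> M} :=
  HB.pack f' (bilinear_isBilinear.Build _ _ _ _ _ _ f' f'P).
have [[g gE] uniq] := tensorR M F; split.
  by exists g => b a; rewrite mulrC gE.
by move=> g1 g2 g1E g2E; apply: uniq => a b; rewrite mulrC ?g1E ?g2E.
Qed.

Lemma ideal_subspace (k : fieldType) (A : comAlgType k) (I : set A) :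
  is_ideal I -> is_subspace I.
Proof.
move=> hI; split=> [|c x y Ix Iy]; first exact: ideal0.
by apply: idealD => //; rewrite -[x]mul1r scalerAl; apply: idealM_l.
Qed.

Section Slices.
Variables (k : fieldType) (A B R : comAlgType k).
Variables (iA : {lrmorphism A -> R}) (iB : {lrmorphism B -> R}).
Hypothesis tensorR : is_tensor_product iA iB.
Implicit Types (I : set A) (J : set B).
Local Notation T := (tensor_ideal iA iB).

Lemma tensor_span r : exists n (a : nat -> A) (b : nat -> B),
  r = \sum_(i < n) iA (a i) * iB (b i).
Proof.
pose V := [set r | exists l : seq (A * B), r = \sum_(p <- l) iA p.1 * iB p.2].
have Vr : V r; last first.
  have [l ->] := Vr; exists (size l), (fun i => (nth 0 l i).1), (fun i => (nth 0 l i).2).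
  by rewrite (big_nth 0) big_mkord.
apply: contrapT => nVr.
have hV : is_subspace V.
  split; first by exists [::]; rewrite big_nil.
  move=> c _ _ [l ->] [m ->]; exists ([seq (c *: p.1, p.2) | p <- l] ++ m).
  rewrite big_cat big_map scaler_sumr; congr (_ + _); apply: eq_bigr => p _ /=.
  by rewrite linearZ /= -scalerAl.
have [phi [phiV phir]] := separating_functional hV nVr.
have zP : bilinear_for *:%R *:%R (fun (_ : A) (_ : B) => 0 : k^o).
  by split=> u c x y /=; rewrite scaler0 addr0.
pose z : {bilinear A -> B -> k^o} :=
  HB.pack (fun (_ : A) (_ : B) => 0 : k^o) (bilinear_isBilinear.Build _ _ _ _ _ _ _ zP).
pose o : {linear R -> k^o} := \0.
have [_ uniq] := tensorR z.
have phi0 : phi =1 o.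
  apply: uniq => // a b; apply: phiV; exists [:: (a, b)].
  by rewrite big_seq1.
by move: phir; rewrite phi0 => /esym/eqP; rewrite oner_eq0.
Qed.

Lemma tensor_ind (P : R -> Prop) : P 0 -> (forall x y, P x -> P y -> P (x + y)) ->
  (forall a b, P (iA a * iB b)) -> forall r, P r.
Proof.
move=> P0 PD Pab r; have [n [a [b ->]]] := tensor_span r.
by elim/big_ind: _.
Qed.

Lemma slice_exists (phi : {linear A -> k^o}) :
  exists g : {linear R -> B}, forall a b, g (iA a * iB b) = (phi a : k) *: b.
Proof.
pose f a (b : B) := (phi a : k) *: b.
have fP : bilinear_for *:%R *:%R f.
  split=> [b|a] c x y; rewrite /f.
    by rewrite linearP scalerDl /= scalerA.
  by rewrite scalerDr /= !scalerA mulrC.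
pose F : {bilinear A -> B -> B} :=
  HB.pack f (bilinear_isBilinear.Build _ _ _ _ _ _ f fP).
by have [[g gE] _] := tensorR F; exists g.
Qed.

(** The slice map [phi (x) id : A (x) B -> B] of a linear form [phi] on [A]. *)
Definition slice (phi : {linear A -> k^o}) : {linear R -> B} :=
  projT1 (cid (slice_exists phi)).

Lemma sliceE phi a b : slice phi (iA a * iB b) = (phi a : k) *: b.
Proof. by rewrite /slice; case: cid. Qed.

Lemma sliceMB phi b r : slice phi (iB b * r) = b * slice phi r.
Proof.
elim/tensor_ind: r => [|x y IHx IHy|a c]; first by rewrite mulr0 linear0 mulr0.
  by rewrite mulrDr !linearD IHx IHy mulrDr.
by rewrite mulrCA -rmorphM !sliceE scalerAr.
Qed.

Lemma slice_mulA (phi : {linear A -> k^o}) x : exists2 psi : {linear A -> k^o},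
  forall a, psi a = phi (x * a) & forall r, slice phi (iA x * r) = slice psi r.
Proof.
pose f a : k^o := phi (x * a).
have flin : linear f by move=> c a b; rewrite /f mulrDr -scalerAr linearP.
pose psi : {linear A -> k^o} := HB.pack f (GRing.isLinear.Build _ _ _ _ f flin).
exists psi => // r; elim/tensor_ind: r => [|y z IHy IHz|a b].
- by rewrite mulr0 !linear0.
- by rewrite mulrDr !linearD IHy IHz.
- by rewrite mulrA -rmorphM !sliceE.
Qed.

(** A sum of tensors [e (x) b] with [e] in [E], whose slices by all the linear forms
    vanishing on [V] lie in [W], belongs to any ideal [N] containing [V (x) B] and
    [E (x) W]. *)
Lemma slice_mem (V E : set A) (W : set B) (N : set R) :
    is_subspace V -> is_subspace W -> is_ideal N ->
    (forall a b, V a -> N (iA a * iB b)) ->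
    (forall a b, E a -> W b -> N (iA a * iB b)) ->
  forall n (a : nat -> A) (b : nat -> B), (forall i, (i < n)%N -> E (a i)) ->
    (forall phi : {linear A -> k^o}, (forall v, V v -> phi v = 0) ->
       W (slice phi (\sum_(i < n) iA (a i) * iB (b i)))) ->
  N (\sum_(i < n) iA (a i) * iB (b i)).
Proof.
move=> hV hW hN VN EWN; elim=> [|n IH] a b Ea sl.
  by rewrite big_ord0; apply: ideal0.
pose X := [set x | exists2 v, V v & exists c : nat -> k,
  x = v + \sum_(i < n) c i *: a i].
have [[v Vv [c anE]]|nXa] := pselect (X (a n)).
  (* The tensor of index n is absorbed by the others, up to V (x) B. *)
  have E1 : \sum_(i < n.+1) iA (a i) * iB (b i) =
      iA v * iB (b n) + \sum_(i < n) iA (a i) * iB (b i + c i *: b n).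
    rewrite big_ord_recr /= anE linearD linear_sum mulrDl mulr_suml addrCA.
    congr (_ + _); rewrite -big_split /=; apply: eq_bigr => i _.
    by rewrite linearD !linearZ mulrDr /= -scalerAl -scalerAr.
  rewrite E1; apply: idealD => //; first exact: VN.
  apply: (IH _ (fun i => b i + c i *: b n)) => [i ltin|phi phiV].
    by apply: Ea; apply: ltnW.
  by move: (sl phi phiV); rewrite E1 linearD sliceE phiV// scale0r add0r.
have hX : is_subspace X.
  split.
    exists 0; first by case: hV.
    by exists (fun=> 0); rewrite big1 ?addr0// => i _; rewrite scale0r.
  move=> c _ _ [v Vv [d ->]] [w Vw [e ->]]; exists (c *: v + w).
    by case: hV => _; apply.
  exists (fun i => c * d i + e i); rewrite scalerDr addrACA; congr (_ + _).
  rewrite scaler_sumr -big_split; apply: eq_bigr => i _ /=.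
  by rewrite scalerDl scalerA.
have VX : V `<=` X.
  move=> v Vv; exists v => //; exists (fun=> 0).
  by rewrite big1 ?addr0// => i _; rewrite scale0r.
(* The slice by a form that is 1 at a_n and vanishes on V and on the other a_i
   is b_n, which therefore lies in W. *)
have [phi [phiX phia]] := separating_functional hX nXa.
have phiV v : V v -> phi v = 0 by move=> /VX/phiX.
have Wbn : W (b n).
  have := sl phi phiV; rewrite big_ord_recr /= linearD sliceE phia scale1r.
  rewrite linear_sum big1 ?add0r// => i _; rewrite sliceE phiX ?scale0r//.
  exists 0; first by case: hV.
  exists (fun j : nat => (j == i :> nat)%:R); rewrite add0r (bigD1 i)//=.
  rewrite eqxx scale1r big1 ?addr0//.
  by move=> j; rewrite -val_eqE => /negPf ->; rewrite scale0r.
rewrite big_ord_recr; apply: idealD => //=; last by apply: EWN => //; apply: Ea.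
apply: IH => [i ltin|psi psiV]; first by apply: Ea; apply: ltnW.
have := sl psi psiV; rewrite big_ord_recr /= linearD sliceE => Wsum.
rewrite -[slice psi _](addrK ((psi (a n) : k) *: b n)).
by apply: subspaceB => //; apply: subspaceZ.
Qed.

Lemma is_ideal_tensor I J : is_ideal (T I J).
Proof. by apply: is_ideal_add; apply: is_ideal_ext. Qed.

Lemma tensor_ideal_l I J a : I a -> T I J (iA a).
Proof. by move=> Ia; apply: ideal_addl; [apply: is_ideal_ext | apply: ideal_extM]. Qed.

Lemma tensor_ideal_r I J b : J b -> T I J (iB b).
Proof. by move=> Jb; apply: ideal_addr; [apply: is_ideal_ext | apply: ideal_extM]. Qed.

Lemma tensor_ideal_sub I J K : is_ideal K ->
  (forall a, I a -> K (iA a)) -> (forall b, J b -> K (iB b)) -> T I J `<=` K.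
Proof. by move=> hK IK JK; apply: ideal_add_sub => //; apply: ideal_ext_sub. Qed.

Lemma tensor_idealS I I' J J' : I `<=` I' -> J `<=` J' -> T I J `<=` T I' J'.
Proof.
move=> II' JJ'; apply: tensor_ideal_sub; first exact: is_ideal_tensor.
  by move=> a /II'; apply: tensor_ideal_l.
by move=> b /JJ'; apply: tensor_ideal_r.
Qed.

Lemma tensor_ideal_slice I J z : is_ideal I -> is_ideal J ->
  T I J z <-> forall phi : {linear A -> k^o}, (forall a, I a -> phi a = 0) ->
    J (slice phi z).
Proof.
move=> hI hJ; split=> [|sl]; last first.
  have [n [a [b zE]]] := tensor_span z; rewrite zE.
  apply: (slice_mem (V := I) (E := setT) (W := J)) => //.
  - exact: ideal_subspace.
  - exact: ideal_subspace.
  - exact: is_ideal_tensor.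
  - by move=> x y Ix; apply: (idealM_r _ (is_ideal_tensor _ _)); apply: tensor_ideal_l.
  - by move=> x y _ Jy; apply: (idealM_l _ (is_ideal_tensor _ _)); apply: tensor_ideal_r.
  - by rewrite -zE.
pose K := [set z | forall phi : {linear A -> k^o}, (forall a, I a -> phi a = 0) ->
  J (slice phi z)].
have hK : is_ideal K.
  split=> [phi _|x y Kx Ky phi phiI|r x]; first by rewrite linear0; apply: ideal0.
    by rewrite linearD; apply: idealD => //; [apply: Kx | apply: Ky].
  move=> Kx; elim/tensor_ind: r => [|r s Kr Ks|a b] phi phiI.
  - by rewrite mul0r linear0; apply: ideal0.
  - by rewrite mulrDl linearD; apply: idealD => //; [apply: Kr | apply: Ks].
  - have [psi psiE sliceE'] := slice_mulA phi a.
    rewrite -mulrA sliceE' sliceMB; apply: idealM_l => //; apply: Kx => c Ic.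
    by rewrite psiE phiI//; apply: idealM_l.
apply: (tensor_ideal_sub hK) => [a Ia phi phiI|b Jb phi phiI].
  by rewrite -[iA a]mulr1 -(rmorph1 iB) sliceE phiI// scale0r; apply: ideal0.
rewrite -[iB b]mul1r -(rmorph1 iA) sliceE; apply: subspaceZ => //.
exact: ideal_subspace.
Qed.

Lemma tensor_ideal_colonB I J b : is_ideal I -> is_ideal J ->
  T I (colon J b) = colon (T I J) (iB b).
Proof.
move=> hI hJ; have hJb : is_ideal (colon J b) by apply: is_ideal_colon.
apply/seteqP; split=> z; rewrite /colon /= mulrC.
  move=> /(tensor_ideal_slice _ hI hJb) zP; apply/tensor_ideal_slice => // phi /zP.
  by rewrite sliceMB mulrC.
move=> /(tensor_ideal_slice _ hI hJ) zP; apply/tensor_ideal_slice => // phi /zP.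
by rewrite sliceMB /colon /= mulrC.
Qed.

Lemma tensor_ideal_bigcapB I (D : Type) (X : set D) (F : D -> set B) :
  is_ideal I -> (forall i, X i -> is_ideal (F i)) ->
  \bigcap_(i in X) T I (F i) `<=` T I (\bigcap_(i in X) F i).
Proof.
move=> hI hF z Tz; apply/tensor_ideal_slice => //; first exact: is_ideal_bigcap.
move=> phi phiI i Xi; move: (Tz i Xi) => /(tensor_ideal_slice _ hI (hF i Xi)).
exact.
Qed.

Lemma ideal_ext_capM I J : is_ideal I -> is_ideal J ->
  ideal_ext iA I `&` ideal_ext iB J `<=` ideal_mul (ideal_ext iA I) (ideal_ext iB J).
Proof.
move=> hI hJ z [Iz Jz].
have [n [a [b [Ia zE]]]] : exists n (a : nat -> A) (b : nat -> B),
    (forall i, (i < n)%N -> I (a i)) /\ z = \sum_(i < n) iA (a i) * iB (b i).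
  pose K := [set z | exists l : seq (A * B), (forall p, p \in l -> I p.1) /\
     z = \sum_(p <- l) iA p.1 * iB p.2].
  have KD x y : K x -> K y -> K (x + y).
    move=> [l [Il ->]] [m [Im ->]]; exists (l ++ m); rewrite big_cat.
    by split=> // p; rewrite mem_cat => /orP[/Il|/Im].
  have [l [Il ->]] : K z.
    move: z Iz {Jz}; apply: ideal_ext_sub => [|x Ix]; last first.
      exists [:: (x, 1)]; rewrite big_seq1 rmorph1 mulr1; split=> // p.
      by rewrite inE => /eqP ->.
    split=> //; first by exists [::]; rewrite big_nil.
    move=> r x Kx; elim/tensor_ind: r => [|r s Kr Ks|c d].
    - by rewrite mul0r; exists [::]; rewrite big_nil.
    - by rewrite mulrDl; apply: KD.
    - case: Kx => l [Il ->]; exists [seq (c * p.1, d * p.2) | p <- l]; split.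
        by move=> _ /mapP[p /Il Ip ->] /=; apply: idealM_l.
      rewrite big_map mulr_sumr; apply: eq_bigr => p _ /=.
      by rewrite !rmorphM mulrACA.
  exists (size l), (fun i => (nth 0 l i).1), (fun i => (nth 0 l i).2); split.
    by move=> i il; apply: Il; rewrite mem_nth.
  by rewrite (big_nth 0) big_mkord.
rewrite zE; apply: (slice_mem (V := [set 0]) (E := I) (W := J)) => //.
- by split=> // c x y -> ->; rewrite scaler0 addr0.
- exact: ideal_subspace.
- exact: is_ideal_mul.
- by move=> x y ->; rewrite rmorph0 mul0r; apply: (ideal0 (is_ideal_mul _ _)).
- by move=> x y Ix Jy; apply: ideal_mulM; apply: ideal_extM.
- rewrite -zE => phi _.
  have : T [set 0] J z by apply: (ideal_addr (is_ideal_ext _ _) Jz).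
  have h0 : is_ideal [set (0 : A)].
    by split=> [//|x y -> ->|r x ->]; rewrite ?addr0 ?mulr0.
  by move=> /(tensor_ideal_slice _ h0 hJ); apply=> x ->; rewrite linear0.
Qed.

End Slices.

(** * Elements regular modulo [I R + J R] *)

Section RegularTransfer.
Variables (k : fieldType) (A B R : comAlgType k).
Variables (iA : {lrmorphism A -> R}) (iB : {lrmorphism B -> R}).
Hypothesis tensorR : is_tensor_product iA iB.
Implicit Types (I : set A) (J : set B) (U : set R).
Local Notation T := (tensor_ideal iA iB).

Lemma tensor_ideal_colonA I J a : is_ideal I -> is_ideal J ->
  T (colon I a) J = colon (T I J) (iA a).
Proof.
move=> hI hJ; rewrite tensor_idealC (tensor_ideal_colonB (tensor_productC tensorR))//.
by rewrite tensor_idealC.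
Qed.

Lemma tensor_ideal_bigcapA J (D : Type) (X : set D) (F : D -> set A) :
  is_ideal J -> (forall i, X i -> is_ideal (F i)) ->
  \bigcap_(i in X) T (F i) J `<=` T (\bigcap_(i in X) F i) J.
Proof.
move=> hJ hF z Fz; rewrite tensor_idealC.
apply: (tensor_ideal_bigcapB (tensor_productC tensorR)) => // i Xi.
by rewrite tensor_idealC; apply: Fz.
Qed.

(** Regular subsets of [A] modulo [I] stay regular modulo [I R + J R], by flatness of
    [A / I -> (A / I) (x) (B / J)]. *)
Lemma regular_mod_extA (V : set A) I J : is_ideal I -> is_ideal J ->
  regular_mod V I -> regular_mod (iA @` V) (T I J).
Proof.
move=> hI hJ reg z Vz.
have hc v : is_ideal (colon I v) by apply: is_ideal_colon.
have : (\bigcap_(v in V) T (colon I v) J) z.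
  move=> v Vv; rewrite tensor_ideal_colonA// /colon /= mulrC; apply: Vz.
  by exists v.
move=> /(tensor_ideal_bigcapA hJ (fun v _ => hc v)).
apply: tensor_idealS => // x cx; apply: reg => v Vv.
by have := cx v Vv; rewrite /colon /= mulrC.
Qed.

(** Regularity modulo [P R + J R] passes from the prime [P] to all the
    [P]-saturated ideals, even to those without [P] as an associated prime. *)
Lemma regular_mod_saturated (noethA : noetherian A) (P : prime_ideal A) J U :
    is_ideal J -> regular_mod U (T (prime_set P) J) ->
  forall I, is_ideal I -> saturated P I -> regular_mod U (T I J).
Proof.
move=> hJ regP; apply: (noetherian_ind noethA) => I hI IH satI z Uz.
have hT I' : is_ideal (T I' J) by apply: is_ideal_tensor.
have [I1|nI1] := pselect (I 1).
  by apply: ideal1 => //; rewrite -(rmorph1 iA); apply: tensor_ideal_l.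
have [Q [t [QE _]]] := prime_above_colon noethA hI nI1.
move: QE; rewrite mulr1 => QE.
have nIt : ~ I t.
  by move=> It; apply: (@prime_setN1 _ Q); rewrite QE /colon /= mul1r.
have QP : prime_set Q `<=` prime_set P.
  move=> a; rewrite QE => Qa; apply: contrapT => Pa; apply: nIt.
  exact: satI Pa Qa.
have [PQ|] := pselect (prime_set P `<=` prime_set Q).
  (* Here (I : t) = P, and I + t A lies one step above I. *)
  have PE : prime_set P = colon I t by rewrite -QE; apply/seteqP.
  set I' := saturation P (ideal_adjoin I t).
  have hadj : is_ideal (ideal_adjoin I t) by apply: is_ideal_adjoin.
  have hI' : is_ideal I' by apply: is_ideal_saturation.
  have II' : I `<=` I'.
    by apply: subset_trans (@sub_saturation _ _ _); apply: sub_ideal_adjoin.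
  have I'z : T I' J z.
    apply: IH => //; last 1 first.
    - by move=> u /Uz; apply: tensor_idealS.
    - move=> /(_ t) I't; apply: nIt; apply: I't.
      exact/sub_saturation/mem_ideal_adjoin.
    - exact: saturated_saturation.
  have [w Pw [r Tr]] : exists2 w, ~ prime_set P w & exists r, T I J (iA w * z - iA t * r).
    pose K := [set z | exists2 w, ~ prime_set P w & exists r, T I J (iA w * z - iA t * r)].
    suff : T I' J `<=` K by apply.
    have TK y : T I J y -> K y.
      move=> Ty; exists 1; first exact: prime_setN1.
      by exists 0; rewrite rmorph1 mul1r mulr0 subr0.
    apply: tensor_ideal_sub => [|a [w Pw [r Ir]]|b Jb]; last first.
    - exact/TK/tensor_ideal_r.
    - exists w => //; exists (iA r); rewrite -!rmorphM -rmorphB.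
      by apply: tensor_ideal_l; rewrite [t * r]mulrC.
    split=> [|x y [w Pw [r Tr]] [v Pv [s Ts]]|y x [w Pw [r Tr]]].
    - by apply: TK; apply: ideal0.
    - exists (w * v); first exact: prime_notinM.
      exists (iA v * r + iA w * s).
      have -> : iA (w * v) * (x + y) - iA t * (iA v * r + iA w * s) =
          iA v * (iA w * x - iA t * r) + iA w * (iA v * y - iA t * s).
        by rewrite rmorphM; ring.
      by apply: idealD => //; apply: idealM_l.
    - exists w => //; exists (y * r).
      have -> : iA w * (y * x) - iA t * (y * r) = y * (iA w * x - iA t * r) by ring.
      exact: idealM_l.
  have TPr : T (prime_set P) J r.
    apply: regP => u Uu; rewrite PE tensor_ideal_colonA// /colon /=.
    have -> : u * r * iA t = iA w * (u * z) - u * (iA w * z - iA t * r) by ring.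
    by apply: idealB => //; apply: idealM_l => //; apply: Uz.
  have : colon (T I J) (iA w) z.
    rewrite /colon /= mulrC; apply: idealBr Tr _ => //.
    by move: TPr; rewrite PE tensor_ideal_colonA// /colon /= mulrC.
  rewrite -tensor_ideal_colonA//; apply: tensor_idealS => // x.
  by rewrite /colon /= mulrC; apply: satI.
(* Here no power of a lies in I, which is contained in Q. *)
move=> /existsNP[a /not_implyP[Pa Qa]].
pose F n := saturation P (ideal_adjoin I (a ^+ n)).
have hF n : is_ideal (F n) by apply: is_ideal_saturation; apply: is_ideal_adjoin.
have IF n : I `<=` F n.
  by apply: subset_trans (@sub_saturation _ _ _); apply: sub_ideal_adjoin.
have Fz : (\bigcap_(n in setT) T (F n) J) z.
  move=> n _; apply: (IH (F n)) => //.
  - move=> /(_ (a ^+ n)) FI; apply: (prime_notX (n := n) Qa); rewrite QE.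
    by apply: idealM_r => //; apply: FI; apply: sub_saturation; apply: mem_ideal_adjoin.
  - exact: saturated_saturation.
  - by move=> u /Uz; apply: tensor_idealS.
move: Fz => /(tensor_ideal_bigcapA hJ (fun n _ => hF n)); apply: tensor_idealS => //.
by move=> x Fx; apply: (krull_principal noethA hI satI Pa) => n; apply: Fx.
Qed.

End RegularTransfer.

(** * Sums of products of two filtrations *)

Section Binomial.
Variables (k : fieldType) (A B R : comAlgType k).
Variables (iA : {lrmorphism A -> R}) (iB : {lrmorphism B -> R}).
Hypothesis tensorR : is_tensor_product iA iB.
Local Notation T := (tensor_ideal iA iB).

(** By the modular law, intersecting the sums [F_i R + G_(s+1-i) R] gives the
    sum of the intersections [F_i R /\ G_(s-i) R], which are products. *)
Lemma tensor_filtration (F : nat -> set A) (G : nat -> set B) s z :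
    (forall i, is_ideal (F i)) -> (forall i, is_ideal (G i)) ->
    (forall i, F i.+1 `<=` F i) -> (forall i, G i.+1 `<=` G i) ->
    F 0%N = setT -> G 0%N = setT ->
    (0 < s)%N ->
    (forall i, (0 < i <= s)%N -> T (F i) (G (s.+1 - i)%N) z) ->
  (\big[@ideal_add R/[set 0]]_(i <- iota 0 s.+1)
     ideal_mul (ideal_ext iA (F i)) (ideal_ext iB (G (s - i)%N))) z.
Proof.
move=> hF hG decF decG F0 G0 s_gt0 Tz.
set X := fun i => ideal_mul (ideal_ext iA (F i)) (ideal_ext iB (G (s - i)%N)).
have hX i : is_ideal (X i) by apply: is_ideal_mul.
have hA i : is_ideal (ideal_ext iA (F i)) by apply: is_ideal_ext.
have hB i : is_ideal (ideal_ext iB (G i)) by apply: is_ideal_ext.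
have extS i : ideal_ext iA (F i.+1) `<=` ideal_ext iA (F i).
  by apply: ideal_ext_sub => // x /decF; apply: ideal_extM.
have extG m n : (m <= n)%N -> ideal_ext iB (G n) `<=` ideal_ext iB (G m).
  move=> /subnK <-; elim: (n - m)%N => // d IH; apply: subset_trans IH.
  by apply: ideal_ext_sub => // x /decG; apply: ideal_extM.
have miota i n : (i < n)%N -> i \in iota 0 n by rewrite mem_iota.
have [y Yy [f Ff zE]] : exists2 y,
    (\big[@ideal_add R/[set 0]]_(i <- iota 0 s) X i) y &
    exists2 f, ideal_ext iA (F s) f & z = y + f; last first.
  rewrite -addn1 iotaD zE /=; apply: idealD; first exact: is_ideal_big.
    move: y Yy {zE}; apply: ideal_big_sub; first exact: is_ideal_big.
    by move=> i ir; apply: ideal_big_sup => //; rewrite mem_cat ir.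
  apply: (ideal_big_sup (i := s)) => //; first by rewrite mem_cat inE add0n eqxx orbT.
  rewrite /X subnn G0 -[f]mulr1; apply: ideal_mulM => //.
  by rewrite -(rmorph1 iB); apply: ideal_extM.
(* Invariant: z is a sum of the first m products up to an element of F_m R. *)
suff: forall m, (0 < m <= s)%N -> exists2 y,
    (\big[@ideal_add R/[set 0]]_(i <- iota 0 m) X i) y &
    exists2 f, ideal_ext iA (F m) f & z = y + f.
  by apply; rewrite s_gt0 leqnn.
elim=> // m IH /andP[_ ms].
have := Tz m.+1; rewrite /= ms => /(_ isT) [f Ff [g Gg zE]].
case: m IH ms f Ff g Gg zE => [|m] IH ms f Ff g Gg zE.
  exists g; last by exists f; rewrite // addrC.
  apply: (ideal_big_sup (i := 0%N)) => //; rewrite -[g]mul1r.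
  apply: ideal_mulM; last first.
    by move: Gg; rewrite subn1 subn0.
  by rewrite F0 -(rmorph1 iA); apply: ideal_extM.
have [|y Yy [f' Ff' zE']] := IH; first by rewrite /= ltnW.
exists (y + (f' - f)); last first.
  by exists f => //; rewrite zE' -addrA subrK.
have hbig : is_ideal (\big[@ideal_add R/[set 0]]_(i <- iota 0 m.+2) X i).
  exact: is_ideal_big.
apply: idealD => //.
  move: y Yy {zE'}; apply: ideal_big_sub => // i.
  rewrite mem_iota add0n => /andP[_ im]; apply: ideal_big_sup => //.
  by apply: (miota i m.+2); rewrite ltnW.
apply: (ideal_big_sup (i := m.+1)) => //; first exact: (miota m.+1 m.+2).
apply: (ideal_ext_capM tensorR (hF m.+1) (hG (s - m.+1)%N)); split.
  by apply: (idealB (hA _)) => //; apply: extS.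
have -> : f' - f = g - y.
  by apply/eqP; rewrite subr_eq addrAC [g + f]addrC zE zE' addrAC subrr add0r.
apply: (idealB (hB _)); first by move: Gg; rewrite subSS.
move: y Yy {zE'}; apply: ideal_big_sub => // i; rewrite mem_iota add0n => /andP[_ im].
apply: ideal_mul_sub => // u v _ Gv; apply: (idealM_l _ (hB _)).
by apply: extG Gv; apply: leq_sub2l; apply: ltnW.
Qed.

End Binomial.

(** * Adjoining an element to a subring *)

Section Subrings.
Variable R : comNzRingType.
Implicit Types (S N : set R) (f g h q : {poly R}).

Definition is_subring S :=
  [/\ S 1, forall x y, S x -> S y -> S (x - y) & forall x y, S x -> S y -> S (x * y)].

Lemma subring1 S : is_subring S -> S 1.
Proof. by case. Qed.

Lemma subringB S x y : is_subring S -> S x -> S y -> S (x - y).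
Proof. by case=> _ + _; apply. Qed.

Lemma subringM S x y : is_subring S -> S x -> S y -> S (x * y).
Proof. by case=> _ _; apply. Qed.

Lemma subring0 S : is_subring S -> S 0.
Proof. by move=> hS; rewrite -(subrr 1); apply: (subringB hS); apply: subring1. Qed.

Lemma subringD S x y : is_subring S -> S x -> S y -> S (x + y).
Proof.
move=> hS Sx Sy; rewrite -[y]opprK -[- y]sub0r; apply: (subringB hS Sx).
by apply: (subringB hS) => //; apply: subring0.
Qed.

Lemma subring_sum S (I : Type) (r : seq I) (F : I -> R) :
  is_subring S -> (forall i, S (F i)) -> S (\sum_(i <- r) F i).
Proof.
by move=> hS SF; elim/big_ind: _ => // *; [apply: subring0 | apply: subringD].
Qed.

Lemma subringX S x n : is_subring S -> S x -> S (x ^+ n).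
Proof.
move=> hS Sx; elim: n => [|n IH]; first exact: subring1.
by rewrite exprS; apply: subringM.
Qed.

(** The coefficients of [f] lie in [S]. *)
Definition poly_over S f := forall i, S f`_i.

Lemma poly_overC S c : is_subring S -> S c -> poly_over S c%:P.
Proof. by move=> hS Sc [|i]; rewrite coefC //=; apply: subring0. Qed.

Lemma poly_overX S : is_subring S -> poly_over S 'X.
Proof.
by move=> hS i; rewrite coefX; case: eqP => _; [case: hS | apply: subring0].
Qed.

Lemma poly_overB S f g :
  is_subring S -> poly_over S f -> poly_over S g -> poly_over S (f - g).
Proof. by case=> _ SB _ Sf Sg i; rewrite coefB; apply: SB. Qed.

Lemma poly_overD S f g :
  is_subring S -> poly_over S f -> poly_over S g -> poly_over S (f + g).
Proof. by move=> hS Sf Sg i; rewrite coefD; apply: subringD. Qed.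

Lemma poly_overM S f g :
  is_subring S -> poly_over S f -> poly_over S g -> poly_over S (f * g).
Proof.
move=> hS Sf Sg i; rewrite coefM; apply: subring_sum => // j.
by case: hS => _ _; apply.
Qed.

Lemma poly_overZ S c f :
  is_subring S -> S c -> poly_over S f -> poly_over S (c *: f).
Proof. by move=> [_ _ SM] Sc Sf i; rewrite coefZ; apply: SM. Qed.

Lemma poly_overXn S n : is_subring S -> poly_over S 'X^n.
Proof. by move=> hS i; rewrite coefXn; case: eqP => _; [case: hS | apply: subring0]. Qed.

Lemma ideal_horner N f x : is_ideal N -> poly_over N f -> N f.[x].
Proof.
move=> hN Nf; rewrite horner_coef; apply: ideal_sum => // i _.
exact: idealM_r.
Qed.

(** The subring [S[x]]. *)
Definition subring_adjoin S x : set R := [set f.[x] | f in poly_over S].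

Lemma is_subring_adjoin S x : is_subring S -> is_subring (subring_adjoin S x).
Proof.
move=> hS; split=> [|_ _ [f Sf <-] [g Sg <-]|_ _ [f Sf <-] [g Sg <-]].
- exists 1%:P; last by rewrite hornerC.
  by apply: poly_overC => //; case: hS.
- by exists (f - g); [apply: poly_overB | rewrite hornerD hornerN].
- by exists (f * g); [apply: poly_overM | rewrite hornerM].
Qed.

Lemma sub_subring_adjoin S x : is_subring S -> S `<=` subring_adjoin S x.
Proof. by move=> hS c Sc; exists c%:P; [apply: poly_overC | rewrite hornerC]. Qed.

Lemma mem_subring_adjoin S x : is_subring S -> subring_adjoin S x x.
Proof. by move=> hS; exists 'X; [apply: poly_overX | rewrite hornerX]. Qed.

(** The image of [S] in [R / N] has no zero divisors. *)
Definition domain_mod N S := forall x y, S x -> S y -> N (x * y) -> N x \/ N y.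

(** Gauss's lemma: if [N] is prime relatively to [S], then [N[X]] is prime
    relatively to [S[X]]. *)
Lemma gauss_mod N S f g : is_ideal N -> domain_mod N S -> poly_over S f ->
  poly_over S g -> poly_over N (f * g) -> poly_over N f \/ poly_over N g.
Proof.
move=> hN domS Sf Sg Nfg; apply: contrapT => /not_orP[/existsNP[i0 Ni0] /existsNP[j0 Nj0]].
have exi : exists i, `[< ~ N f`_i >] by exists i0; apply/asboolP.
have exj : exists j, `[< ~ N g`_j >] by exists j0; apply/asboolP.
case: (ex_minnP exi) => i /asboolP Ni mini.
case: (ex_minnP exj) => j /asboolP Nj minj.
suff : N (f`_i * g`_j) by move=> /(domS _ _ (Sf i) (Sg j))[/Ni|/Nj].
have ltij : (i < (i + j).+1)%N by rewrite ltnS leq_addr.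
have := Nfg (i + j)%N; rewrite coefM (bigD1 (Ordinal ltij)) //= addKn addrC.
move=> /(idealDr hN); apply; apply: ideal_sum => // l; rewrite -val_eqE /= => li.
have [lti|] := ltnP l i.
  apply: idealM_r => //; apply: contrapT => Nl.
  by have := mini l (introT (asboolP _) Nl); rewrite leqNgt lti.
rewrite leq_eqVlt eq_sym (negPf li) /= => ltl.
apply: idealM_l => //; apply: contrapT => Nl.
have := minj _ (introT (asboolP _) Nl); rewrite leqNgt => /negP; apply.
by rewrite ltn_subLR ?ltn_add2r// -ltnS.
Qed.

(** [x] is transcendental over [S] modulo [N]. *)
Definition transcendental_mod N S x :=
  forall f, poly_over S f -> N f.[x] -> poly_over N f.

Lemma domain_mod_adjoin N S x : is_ideal N -> is_subring S -> domain_mod N S ->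
  transcendental_mod N S x -> domain_mod N (subring_adjoin S x).
Proof.
move=> hN hS domS trx _ _ [f Sf <-] [g Sg <-]; rewrite -hornerM.
move=> /(trx _ (poly_overM hS Sf Sg))/(gauss_mod hN domS Sf Sg).
by case=> Nf; [left | right]; apply: ideal_horner.
Qed.

Lemma pseudo_division S g n h : is_subring S -> poly_over S g -> size g = n.+1 ->
  poly_over S h -> exists m q r, [/\ poly_over S q, poly_over S r,
    g`_n ^+ m *: h = q * g + r, (size q <= size h - n)%N & (size r <= n)%N].
Proof.
move=> hS Sg sg; have [d] := ubnP (size h); elim: d h => // d IH h; rewrite ltnS => hd Sh.
have [hn|nh] := leqP (size h) n.
  exists 0%N, 0, h; split=> //; last by rewrite size_poly0.
    by move=> i; rewrite coef0; apply: subring0.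
  by rewrite scale1r mul0r add0r.
set c := g`_n; set l := (size h - n.+1)%N; set b := lead_coef h.
have Sc : S c by apply: Sg.
have Sb : S b by apply: Sh.
have St : poly_over S (b *: 'X^l) by apply: poly_overZ => //; apply: poly_overXn.
pose h' := c *: h - b *: 'X^l * g.
have Sh' : poly_over S h'.
  by apply: poly_overB => //; [apply: poly_overZ | apply: poly_overM].
have sh' : (size h' <= (size h).-1)%N.
  apply/leq_sizeP => j; rewrite -ltnS prednK; last by apply: leq_ltn_trans nh.
  rewrite leq_eqVlt => hj; rewrite coefB coefZ -scalerAl coefZ coefXnM.
  have hh : (0 < size h)%N by apply: leq_ltn_trans nh.
  have lj : (l <= j)%N by rewrite /l; move: hj hh => /orP[/eqP|]; lia.
  rewrite ltnNge lj /=; case/orP: hj => [/eqP hj|hj].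
    have -> : (j - l)%N = n by rewrite /l; lia.
    by rewrite /b lead_coefE hj /= mulrC subrr.
  have -> : h`_j = 0 by apply: nth_default; exact: hj.
  have -> : g`_(j - l) = 0 by apply: nth_default; rewrite sg /l; lia.
  by rewrite !mulr0 subrr.
have [|//|m [q [r [Sq Sr E sq sr]]]] := IH h'.
  by apply: leq_ltn_trans sh' _; lia.
exists m.+1, (q + c ^+ m *: (b *: 'X^l)), r; split=> //.
- by apply: poly_overD => //; apply: poly_overZ => //; apply: subringX.
- rewrite mulrDl addrAC -E /h' scalerBr -(scalerAl (c ^+ m)) subrK.
  by rewrite exprSr scalerA.
- apply: leq_trans (size_polyD _ _) _; rewrite geq_max; apply/andP; split.
    by apply: leq_trans sq _; lia.
  do 2![apply: leq_trans (size_scale_leq _ _) _].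
  by rewrite size_polyXn /l; lia.
Qed.

(** [x] is algebraic over [S] modulo [N]. *)
Definition algebraic_mod N S x :=
  exists f, [/\ poly_over S f, N f.[x] & ~ poly_over N f].

Lemma poly_min_size (C : {poly R} -> Prop) : (exists f, C f) ->
  exists2 f, C f & forall g, C g -> (size f <= size g)%N.
Proof.
move=> [f0 Cf0].
have ex : exists n, `[< exists2 f, C f & size f = n >].
  by exists (size f0); apply/asboolP; exists f0.
case: (ex_minnP ex) => _ /asboolP[f Cf <-] minf; exists f => // g Cg.
by apply: minf; apply/asboolP; exists g.
Qed.

(** Incomparability: if [x] is algebraic over [S] modulo the prime [P], a prime
    [Q] above [P] that agrees with [P] on [S] also agrees with it on [S[x]]. *)
Lemma prime_adjoin_algebraic S (P Q : prime_ideal R) x :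
    is_subring S -> prime_set P `<=` prime_set Q ->
    (forall y, S y -> prime_set Q y -> prime_set P y) ->
    algebraic_mod (prime_set P) S x ->
  forall y, subring_adjoin S x y -> prime_set Q y -> prime_set P y.
Proof.
move=> hS PQ QS algx.
(* f and g play the roles of the minimal polynomials of x modulo P and Q; the
   pseudo-division by g of f, then of any polynomial, brings everything back to g(x) being in P. *)
have [f [Sf Pf nPf] minf] := poly_min_size algx.
have hP := prime_setI P; have hQ := prime_setI Q.
have algQ : algebraic_mod (prime_set Q) S x.
  exists f; split=> // [|Qf]; first exact: PQ.
  by apply: nPf => i; apply: QS.
have [g [Sg Qg nQg] ming] := poly_min_size algQ.
have nsz h : poly_over S h -> prime_set Q h.[x] -> (size h < size g)%N ->
    poly_over (prime_set P) h.
  move=> Sh Qh hg; apply: contrapT => nPh.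
  have : (size g <= size h)%N.
    by apply: ming; split=> // Qh'; apply: nPh => i; apply: QS.
  by rewrite leqNgt hg.
case sg: (size g) => [|n].
  move/eqP: sg; rewrite size_poly_eq0 => /eqP g0; case: nQg => i.
  by rewrite g0 coef0; apply: ideal0.
set c := g`_n.
have Sc : S c by apply: Sg.
have Pc : ~ prime_set P c.
  move=> Pc; have /nsz : poly_over S (g - c *: 'X^n).
    by apply: poly_overB => //; apply: poly_overZ => //; apply: poly_overXn.
  have Qc := PQ _ Pc.
  rewrite hornerD hornerN hornerZ => /(_ (idealB hQ Qg (idealM_r _ hQ Qc))).
  have sz : (size (g - c *: 'X^n)%R < size g)%N.
    rewrite sg ltnS; apply/leq_sizeP => j; rewrite leq_eqVlt coefB coefZ coefXn.
    case/orP => [/eqP <-|nj]; first by rewrite eqxx mulr1 subrr.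
    by rewrite nth_default ?sg// gtn_eqF// mulr0 subr0.
  move=> /(_ sz) Ph; apply: nQg => i.
  have := Ph i; rewrite coefB => /(idealBr hP) H; apply: PQ; apply: H.
  by rewrite coefZ; apply: idealM_r.
have rem h : poly_over S h -> prime_set Q h.[x] -> exists m q r,
    [/\ poly_over S q, poly_over (prime_set P) r, c ^+ m *: h = q * g + r &
    (size q <= size h - n)%N].
  move=> Sh Qh; have [m [q [r [Sq Sr E sq sr]]]] := pseudo_division hS Sg sg Sh.
  exists m, q, r; split=> //; apply: nsz => //; last by rewrite sg ltnS.
  have -> : r = c ^+ m *: h - q * g by rewrite E addrAC subrr add0r.
  by rewrite hornerD hornerN hornerZ hornerM; apply: idealB => //; apply: idealM_l.
have Pcm m z : prime_set P (c ^+ m * z) -> prime_set P z.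
  by move=> /prime_setM[/(prime_notX Pc)|].
have Pg : prime_set P g.[x].
  have [m [q [r [Sq Pr E sq]]]] := rem f Sf (PQ _ Pf).
  have : prime_set P (q.[x] * g.[x]).
    have -> : q.[x] * g.[x] = c ^+ m * f.[x] - r.[x].
      by rewrite -(hornerZ (c ^+ m)) E hornerD hornerM addrK.
    by apply: idealB => //; [apply: idealM_l | apply: ideal_horner].
  case/prime_setM => // Pq.
  have nPq : ~ poly_over (prime_set P) q.
    move=> Pq'; apply: nPf => i; apply: (Pcm m); rewrite -coefZ E coefD.
    apply: idealD => //; rewrite coefM; apply: ideal_sum => // j _.
    exact: idealM_r.
  have fq : (size f <= size q)%N by apply: minf.
  have f0 : (0 < size f)%N.
    rewrite lt0n size_poly_eq0; apply/negP => /eqP f0; apply: nPf => i.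
    by rewrite f0 coef0; apply: ideal0.
  (* Comparing sizes, g is a constant, which lies in both S and Q. *)
  have n0 : n = 0%N by lia.
  have gE : g = c%:P by rewrite /c n0; apply: size1_polyC; rewrite sg n0.
  by case: Pc; apply: QS => //; move: Qg; rewrite gE hornerC.
move=> _ [h Sh <-] Qh; have [m [q [r [Sq Pr E sq]]]] := rem h Sh Qh.
apply: (Pcm m); rewrite -hornerZ E hornerD hornerM.
by apply: idealD => //; [apply: idealM_l | apply: ideal_horner].
Qed.

End Subrings.

(** * The ring [(A / p) (x) (B / q)] has no embedded primes *)

Section Unmixed.
Variables (k : fieldType) (A B R : comAlgType k).
Variables (iA : {lrmorphism A -> R}) (iB : {lrmorphism B -> R}).
Hypothesis tensorR : is_tensor_product iA iB.
Variables (p : prime_ideal A) (q : prime_ideal B).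
Let N : set R := tensor_ideal iA iB (prime_set p) (prime_set q).

Let hp : is_ideal (prime_set p). Proof. exact: prime_setI. Qed.
Let hq : is_ideal (prime_set q). Proof. exact: prime_setI. Qed.
Let hN : is_ideal N. Proof. exact: is_ideal_tensor. Qed.

(** Slices by linear forms on [B]; these are [A]-linear maps [R -> A]. *)
Let sl (psi : {linear B -> k^o}) : {linear R -> A} :=
  slice (tensor_productC tensorR) psi.

Let slM psi a r : sl psi (iA a * r) = a * sl psi r.
Proof. exact: sliceMB. Qed.

Let N_slice z : N z <-> forall psi : {linear B -> k^o},
  (forall b, prime_set q b -> psi b = 0) -> prime_set p (sl psi z).
Proof. by rewrite /N tensor_idealC; apply: tensor_ideal_slice. Qed.

Let N_regular a z : ~ prime_set p a -> N (iA a * z) -> N z.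
Proof.
move=> pa /N_slice Nz; apply/N_slice => psi /Nz.
by rewrite slM => /prime_setM[].
Qed.

Let N_iB b : N (iB b) -> prime_set q b.
Proof.
have [phi [phip phi1]] :=
  separating_functional (ideal_subspace hp) (@prime_setN1 _ p).
move=> /(tensor_ideal_slice tensorR _ hp hq) /(_ phi phip).
by rewrite -[iB b]mul1r -(rmorph1 iA) sliceE phi1 scale1r.
Qed.

(** The subrings of [R] of the form [C (x) B], with [C] a subalgebra of [A]: they
    are those containing [B] and the slices of their elements. *)
Definition slice_subring (S : set R) := [/\ is_subring S, forall b, S (iB b)
  & forall psi x, S x -> S (iA (sl psi x))].

Lemma slice_subring_base : slice_subring (range iB).
Proof.
split=> [|b|psi _ [b _ <-]]; last 2 first.
- by exists b.
- exists ((psi b : k) *: 1) => //.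
  rewrite -[iB b]mulr1 -(rmorph1 iA) /sl sliceE !linearZ /= !rmorph1 //.
split; first by exists 1; rewrite ?rmorph1.
  by move=> _ _ [b _ <-] [c _ <-]; exists (b - c); rewrite ?rmorphB.
by move=> _ _ [b _ <-] [c _ <-]; exists (b * c); rewrite ?rmorphM.
Qed.

Lemma domain_mod_base : domain_mod N (range iB).
Proof.
move=> _ _ [b _ <-] [c _ <-]; rewrite -rmorphM => /N_iB/prime_setM.
by case=> qb; [left | right]; apply: tensor_ideal_r.
Qed.

Lemma slice_subring_adjoin (S : set R) a :
  slice_subring S -> slice_subring (subring_adjoin S (iA a)).
Proof.
move=> [hS SB Ssl]; split; first exact: is_subring_adjoin.
  by move=> b; apply: sub_subring_adjoin.
move=> psi _ [f Sf <-]; exists (\poly_(i < size f) iA (sl psi f`_i)).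
  move=> i; rewrite coef_poly; case: ifP => _; first exact: Ssl.
  exact: subring0.
rewrite horner_poly horner_coef linear_sum rmorph_sum; apply: eq_bigr => i _ /=.
by rewrite -rmorphXn [f`_i * _]mulrC slM rmorphM mulrC.
Qed.

(** An element of [C (x) B] is a nonzerodivisor on [R] modulo [N] as soon as
    [C (x) B] is a domain modulo [N], because [A / p] is torsion-free over [C]:
    relations over [C] between elements of [A] can be used to shorten an
    expression [\sum_i y_i r_i] with [r_i] in [C (x) B]. *)
Lemma domain_mod_regular (S : set R) d : slice_subring S -> domain_mod N S ->
  S d -> ~ N d -> forall z, N (d * z) -> N z.
Proof.
move=> [hS SB Ssl] domS Sd Nd z.
have key n (y : nat -> A) (r : nat -> R) : (forall i, S (r i)) ->
    N (d * \sum_(i < n) iA (y i) * r i) -> N (\sum_(i < n) iA (y i) * r i).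
  elim: n r => [|n IH] r Sr Ndz; first by rewrite big_ord0; apply: ideal0.
  have [[c [Sc pcn pc]]|indep] := pselect (exists c : nat -> A,
      [/\ forall i, S (iA (c i)), ~ prime_set p (c n)
        & prime_set p (\sum_(i < n.+1) c i * y i)]).
    pose r' i := iA (c n) * r i - iA (c i) * r n.
    have E : iA (c n) * (\sum_(i < n.+1) iA (y i) * r i) =
        \sum_(i < n) iA (y i) * r' i + iA (\sum_(i < n.+1) c i * y i) * r n.
      rewrite !big_ord_recr /= rmorphD rmorph_sum mulrDl mulrDr addrA; congr (_ + _).
        rewrite mulr_sumr mulr_suml -big_split; apply: eq_bigr => i _.
        by rewrite /r' rmorphM /=; ring.
      by rewrite rmorphM; ring.
    have Nrel : N (iA (\sum_(i < n.+1) c i * y i) * r n).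
      by apply: idealM_r => //; apply: tensor_ideal_l.
    apply: (N_regular pcn); rewrite E; apply: idealD => //; apply: IH => [i|].
      by apply: subringB => //; apply: subringM.
    apply: (@idealBr _ N _ (- (d * (iA (\sum_(i < n.+1) c i * y i) * r n)))) => //.
      by rewrite opprK -mulrDr -E mulrCA; apply: idealM_l.
    by apply: idealN => //; apply: idealM_l.
  have Nrn : N (r n).
    have [] // : N d \/ N (r n).
    apply: domS => //; apply/N_slice => psi psiq; apply: contrapT => pdr.
    apply: indep; exists (fun i => sl psi (d * r i)); split=> //.
      by move=> i; apply: Ssl; apply: subringM.
    have := Ndz; rewrite mulr_sumr => /N_slice/(_ psi psiq).
    rewrite linear_sum /=.
    by under eq_bigr => i _ do rewrite mulrCA slM mulrC.
  move: Ndz; rewrite !big_ord_recr /= mulrDr => Ndz.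
  have Nyr : N (iA (y n) * r n) by apply: idealM_l.
  apply: idealD => //; apply: IH => //.
  apply: idealDr hN _ (idealM_l d hN Nyr); by rewrite addrC.
have [n [a [b ->]]] := tensor_span tensorR z.
by apply: (key n a (iB \o b)) => i; apply: SB.
Qed.

(** Here [S = C (x) B], with [C] generated by a maximal subfamily of [l] that is
    algebraically independent modulo [p]. *)
Lemma algebraic_over_domain (l : seq A) : exists S : set R,
  [/\ slice_subring S, domain_mod N S
    & forall a, a \in l -> algebraic_mod N S (iA a)].
Proof.
elim: l => [|a l [S [sS domS algS]]].
  exists (range iB); split=> //; [exact: slice_subring_base | exact: domain_mod_base].
have hS : is_subring S by case: sS.
have [alga|nalga] := pselect (algebraic_mod N S (iA a)).
  by exists S; split=> // b; rewrite in_cons => /predU1P[->|/algS].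
exists (subring_adjoin S (iA a)); split.
- exact: slice_subring_adjoin.
- apply: domain_mod_adjoin => // f Sf Nf; apply: contrapT => nNf.
  by apply: nalga; exists f.
move=> b; rewrite in_cons => /predU1P[->|/algS[f [Sf Nf nNf]]]; last first.
  by exists f; split=> // i; apply: sub_subring_adjoin.
exists ('X - (iA a)%:P); split.
- have hS' := is_subring_adjoin (iA a) hS.
  apply: poly_overB => //; first exact: poly_overX.
  by apply: poly_overC => //; apply: mem_subring_adjoin.
- by rewrite hornerXsubC subrr; apply: ideal0.
- move=> /(_ 1%N); rewrite coefB coefX coefC subr0 => N1.
  by apply: (@prime_setN1 _ q); apply: N_iB; rewrite rmorph1.
Qed.

(** Associated primes of [N] are minimal over [N]. *)
Lemma tensor_unmixed (P Q : prime_ideal R) z : prime_set Q = colon N z ->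
  N `<=` prime_set P -> prime_set P `<=` prime_set Q ->
  prime_set Q `<=` prime_set P.
Proof.
move=> QE NP PQ u.
have nNz : ~ N z.
  by move=> Nz; apply: (@prime_setN1 _ Q); rewrite QE /colon /= mul1r.
have [n [a [b ->]]] := tensor_span tensorR u.
have [S [sS domS algS]] := algebraic_over_domain (mkseq a n).
have [hS SB _] := sS.
have QN y : S y -> prime_set Q y -> N y.
  move=> Sy; rewrite QE => Nyz; apply: contrapT => Ny; apply: nNz.
  exact: domain_mod_regular sS domS Sy Ny _ Nyz.
have [S' [hS' SS' QS' aS']] : exists S' : set R, [/\ is_subring S', S `<=` S',
    forall y, S' y -> prime_set Q y -> prime_set P y
    & forall c, c \in mkseq a n -> S' (iA c)].
  elim: (mkseq a n) algS => [|c l IH] algS.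
    by exists S; split=> // y Sy /(QN _ Sy)/NP.
  have [|S' [hS' SS' QS' lS']] := IH.
    by move=> e el; apply: algS; rewrite in_cons el orbT.
  exists (subring_adjoin S' (iA c)); split.
  - exact: is_subring_adjoin.
  - by apply: subset_trans SS' _; apply: sub_subring_adjoin.
  - apply: prime_adjoin_algebraic => //.
    have [f [Sf Nf nNf]] := algS c (mem_head _ _).
    exists f; split=> [i||Pf]; [exact/SS' | exact: NP |].
    by apply: nNf => i; apply: QN => //; apply: PQ.
  - move=> e; rewrite in_cons => /predU1P[->|/lS'].
      exact: mem_subring_adjoin.
    exact: sub_subring_adjoin.
apply: QS'; apply: subring_sum => // i; apply: subringM => //; last by apply: SS'.
by apply: aS'; apply/mapP; exists (i : nat); rewrite // mem_iota /=.
Qed.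

End Unmixed.

(** * Symbolic powers of [I R + J R] *)

Section SymbolicSum.
Variables (k : fieldType) (A B R : comAlgType k).
Variables (iA : {lrmorphism A -> R}) (iB : {lrmorphism B -> R}).
Hypothesis tensorR : is_tensor_product iA iB.
Local Notation T := (tensor_ideal iA iB).
Variables (I : set A) (J : set B).
Hypotheses (idealI : is_ideal I) (idealJ : is_ideal J).

Lemma tensor_ideal_pow_sub s i j : (i + j = s.+1)%N ->
  ideal_pow (T I J) s `<=` T (ideal_pow I i) (ideal_pow J j).
Proof.
have hT i' j' : is_ideal (T (ideal_pow I i') (ideal_pow J j')).
  exact: is_ideal_tensor.
have T0 i' j' z : (i' == 0) || (j' == 0) -> T (ideal_pow I i') (ideal_pow J j') z.
  case/orP => /eqP ->; apply: ideal1 => //.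
    by rewrite -(rmorph1 iA); apply: tensor_ideal_l.
  by rewrite -(rmorph1 iB); apply: tensor_ideal_r.
elim: s i j => [|s IH] [|i] [|j] ij z; try by move=> _; apply: T0.
  by exfalso; lia.
suff sub : ideal_pow (T I J) s.+1 `<=` T (ideal_pow I i.+1) (ideal_pow J j.+1).
  exact: sub.
apply: ideal_mul_sub => // x w Tx Jw; rewrite mulrC.
suff : T I J `<=` colon (T (ideal_pow I i.+1) (ideal_pow J j.+1)) w.
  by move=> /(_ x Tx); rewrite /colon /= mulrC.
apply: tensor_ideal_sub => [|a Ia|b Jb]; first exact: is_ideal_colon.
  have /(IH i j.+1) : ideal_pow (T I J) s w by [].
  move=> /(_ ltac:(lia)).
  suff : T (ideal_pow I i) (ideal_pow J j.+1) `<=`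
      colon (T (ideal_pow I i.+1) (ideal_pow J j.+1)) (iA a).
    by move=> /[apply]; rewrite /colon /= mulrC.
  apply: tensor_ideal_sub => [|c Ic|c Jc]; first exact: is_ideal_colon.
    by rewrite /colon /= -rmorphM; apply: tensor_ideal_l; rewrite mulrC; apply: ideal_mulM.
  by apply: idealM_r => //; apply: tensor_ideal_r.
have /(IH i.+1 j) : ideal_pow (T I J) s w by [].
move=> /(_ ltac:(lia)).
suff : T (ideal_pow I i.+1) (ideal_pow J j) `<=`
    colon (T (ideal_pow I i.+1) (ideal_pow J j.+1)) (iB b).
  by move=> /[apply]; rewrite /colon /= mulrC.
apply: tensor_ideal_sub => [|c Ic|c Jc]; first exact: is_ideal_colon.
  by apply: idealM_r => //; apply: tensor_ideal_l.
by rewrite /colon /= -rmorphM; apply: tensor_ideal_r; rewrite mulrC; apply: ideal_mulM.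
Qed.

Variables (Ps : set (prime_ideal A)) (Qs : set (prime_ideal B)).

Lemma symbolic_sum_sub (noethA : noetherian A) (noethB : noetherian B)
    (U : set R) s x : (0 < s)%N ->
    (forall p q, Ps p -> Qs q -> regular_mod U (T (prime_set p) (prime_set q))) ->
    (forall u, U u -> ideal_pow (T I J) s (u * x)) ->
  (\big[@ideal_add R/[set 0]]_(i < s.+1)
     ideal_mul (ideal_ext iA (symbolic_power Ps I i))
               (ideal_ext iB (symbolic_power Qs J (s - i)%N))) x.
Proof.
move=> s_gt0 regU Ux.
rewrite -(big_mkord xpredT (fun i => ideal_mul (ideal_ext iA (symbolic_power Ps I i))
  (ideal_ext iB (symbolic_power Qs J (s - i)%N)))) /index_iota subn0.
have satI p i : is_ideal (saturation p (ideal_pow I i)).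
  by apply: is_ideal_saturation; apply: is_ideal_pow.
have satJ q j : is_ideal (saturation q (ideal_pow J j)).
  by apply: is_ideal_saturation; apply: is_ideal_pow.
have regsat p q i j : Ps p -> Qs q ->
    regular_mod U (T (saturation p (ideal_pow I i)) (saturation q (ideal_pow J j))).
  move=> Pp Qq; rewrite tensor_idealC.
  apply: (regular_mod_saturated (tensor_productC tensorR) noethB (P := q)) => //.
    rewrite tensor_idealC.
    apply: (regular_mod_saturated tensorR noethA (P := p)) => //.
    - exact: prime_setI.
    - exact: regU.
    - exact: saturated_saturation.
  exact: saturated_saturation.
apply: (tensor_filtration tensorR) => //.
- by move=> i; apply: is_ideal_symbolic.
- by move=> i; apply: is_ideal_symbolic.
- by move=> i; apply: symbolic_subS.
- by move=> i; apply: symbolic_subS.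
- exact: symbolic_power0.
- exact: symbolic_power0.
move=> i /andP[i_gt0 le_is]; set j := (s.+1 - i)%N.
rewrite !symbolic_power_bigcap.
apply: (tensor_ideal_bigcapA tensorR) => // [|p Pp].
  by apply: is_ideal_bigcap => q _.
apply: (tensor_ideal_bigcapB tensorR) => // q Qq.
apply: (regsat p q i j Pp Qq) => u /Ux.
have ij : (i + j = s.+1)%N by rewrite /j; lia.
move=> /(tensor_ideal_pow_sub ij); apply: tensor_idealS; exact: sub_saturation.
Qed.

Lemma symbolic_sum_sup (Ss : set (prime_ideal R)) s :
    (forall P i x, Ss P -> symbolic_power Ps I i x ->
       exists2 u, ~ prime_set P (iA u) & ideal_pow I i (u * x)) ->
    (forall P j y, Ss P -> symbolic_power Qs J j y ->
       exists2 v, ~ prime_set P (iB v) & ideal_pow J j (v * y)) ->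
  \big[@ideal_add R/[set 0]]_(i < s.+1)
     ideal_mul (ideal_ext iA (symbolic_power Ps I i))
               (ideal_ext iB (symbolic_power Qs J (s - i)%N))
  `<=` symbolic_power Ss (T I J) s.
Proof.
move=> contA contB.
rewrite -(big_mkord xpredT (fun i => ideal_mul (ideal_ext iA (symbolic_power Ps I i))
  (ideal_ext iB (symbolic_power Qs J (s - i)%N)))) /index_iota subn0.
have hS : is_ideal (symbolic_power Ss (T I J) s) by apply: is_ideal_symbolic.
apply: ideal_big_sub => // i; rewrite mem_iota add0n ltnS => /andP[_ le_is].
apply: ideal_mul_sub => // x y Ix Jy.
suff /(_ x Ix) : ideal_ext iA (symbolic_power Ps I i) `<=`
  colon (symbolic_power Ss (T I J) s) y by [].
apply: ideal_ext_sub => [|a Ia]; first exact: is_ideal_colon.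
rewrite /colon /= mulrC.
suff /(_ y Jy) : ideal_ext iB (symbolic_power Qs J (s - i)) `<=`
  colon (symbolic_power Ss (T I J) s) (iA a) by [].
apply: ideal_ext_sub => [|b Jb]; first exact: is_ideal_colon.
rewrite /colon /= mulrC; apply/symbolic_powerP => P SP.
have [u Pu Iua] := contA P i a SP Ia; have [v Pv Jvb] := contB P (s - i)%N b SP Jb.
exists (iA u * iB v); first exact: prime_notinM.
rewrite mulrACA -!rmorphM -(subnKC le_is); apply: ideal_powD.
  apply: ideal_pow_rmorph Iua => c; exact: tensor_ideal_l.
apply: ideal_pow_rmorph Jvb => c; exact: tensor_ideal_r.
Qed.

End SymbolicSum.

(** * Associated and minimal primes of [I R + J R] *)

Section Contraction.
Variables (k : fieldType) (A B R : comAlgType k).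
Variables (iA : {lrmorphism A -> R}) (iB : {lrmorphism B -> R}).
Hypothesis tensorR : is_tensor_product iA iB.
Hypotheses (noethA : noetherian A) (noethR : noetherian R).
Local Notation T := (tensor_ideal iA iB).
Variables (I : set A) (J : set B).
Hypotheses (idealI : is_ideal I) (idealJ : is_ideal J).

Lemma ass_symbolic_contract (P : prime_ideal R) i x : Ass (T I J) P ->
  ass_symbolic_power I i x ->
  exists2 u, ~ prime_set P (iA u) & ideal_pow I i (u * x).
Proof.
move=> [z PE] /symbolic_powerP Ix; apply: contrapT => nex.
pose V := [set u | ideal_pow I i (u * x)].
have regV : regular_mod V I.
  apply: (regular_mod_Ass noethA) => // Q AQ VQ.
  by have [u Qu Vu] := Ix Q AQ; apply/Qu/VQ.
have Tz : T I J z.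
  apply: (regular_mod_extA tensorR idealI idealJ regV) => _ [u Vu <-].
  apply: contrapT => Tuz; apply: nex; exists u => //.
  by rewrite PE.
by apply: (@prime_setN1 _ P); rewrite PE /= mul1r.
Qed.

(** A minimal prime of [I R + J R] contracts to a minimal prime of [I]: a form
    of going down for the flat map [A / I -> (A / I) (x) (B / J)]. *)
Lemma min_contract (P : prime_ideal R) :
  Min (T I J) P -> Min I (PrimeIdeal (is_prime_preim iA P)).
Proof.
move=> minP; have [TP _] := minP; split=> [a Ia|q Iq qP /=].
  exact/TP/tensor_ideal_l.
apply/seteqP; split=> // a Pa; apply: contrapT => qa.
have [w [n [Pw Twa]]] := Min_nilpotent noethR (is_ideal_tensor _ _ _ _) minP Pa.
have hq := prime_setI q.
have regn : regular_mod (iA @` [set a ^+ n]) (T (prime_set q) J).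
  apply: (regular_mod_extA tensorR) => // b /(_ _ erefl)/prime_setM.
  by case=> // /(prime_notX qa).
apply: Pw; have : T (prime_set q) J w.
  apply: regn => _ [_ -> <-]; rewrite rmorphXn mulrC.
  exact: tensor_idealS Twa.
apply: tensor_ideal_sub => [|b /qP //|b Jb]; first exact: prime_setI.
exact/TP/tensor_ideal_r.
Qed.

Lemma min_symbolic_contract (P : prime_ideal R) i x : Min (T I J) P ->
  min_symbolic_power I i x ->
  exists2 u, ~ prime_set P (iA u) & ideal_pow I i (u * x).
Proof. by move=> /min_contract minP /symbolic_powerP /(_ _ minP). Qed.

Lemma ass_symbolic_regular s x p q : ass_symbolic_power (T I J) s x ->
  Ass I p -> Ass J q ->
  regular_mod [set u | ideal_pow (T I J) s (u * x)] (T (prime_set p) (prime_set q)).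
Proof.
move=> /symbolic_powerP Tx [e pE] [f qE]; set U := [set u | _].
have regT : regular_mod U (T I J).
  apply: (regular_mod_Ass noethR); first exact: is_ideal_tensor.
  by move=> P AP UP; have [u Pu Uu] := Tx P AP; apply/Pu/UP.
have hp := prime_setI p.
rewrite qE (tensor_ideal_colonB tensorR)//; apply: regular_mod_colon.
by rewrite pE (tensor_ideal_colonA tensorR)//; apply: regular_mod_colon.
Qed.

Lemma tensor_prime_regular (p : prime_ideal A) (K : set B) a z : is_ideal K ->
  ~ prime_set p a -> T (prime_set p) K (iA a * z) -> T (prime_set p) K z.
Proof.
move=> hK pa Taz; have hp := prime_setI p.
apply: (regular_mod_extA tensorR (V := [set a])) => // [b /(_ _ erefl)/prime_setM[]//|].
by move=> _ [_ -> <-].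
Qed.

(** If the elements of [A] outside of the minimal prime [p] of [I] are regular
    modulo [N], a prime between [T I J] and an associated prime [Q] of [N] contains
    [p], to which it contracts. *)
Lemma prime_contract_sub (p : prime_ideal A) (P Q : prime_ideal R) N z :
  Min I p -> (forall a z, ~ prime_set p a -> N (iA a * z) -> N z) ->
  prime_set Q = colon N z -> T I J `<=` prime_set P ->
  prime_set P `<=` prime_set Q ->
  forall a, prime_set p a -> prime_set P (iA a).
Proof.
move=> [_ minp] regN QE TP PQ.
have nNz : ~ N z.
  by move=> Nz; apply: (@prime_setN1 _ Q); rewrite QE /colon /= mul1r.
have Pp a : prime_set P (iA a) -> prime_set p a.
  move=> /PQ; rewrite QE => Naz; apply: contrapT => pa; apply: nNz.
  exact: regN Naz.
move=> a; rewrite -(minp (PrimeIdeal (is_prime_preim iA P))) //= => b Ib.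
exact/TP/tensor_ideal_l.
Qed.

End Contraction.

Lemma min_symbolic_regular (k : fieldType) (A B R : comAlgType k)
    (iA : {lrmorphism A -> R}) (iB : {lrmorphism B -> R})
    (tensorR : is_tensor_product iA iB) (noethR : noetherian R)
    (I : set A) (J : set B) s x p q :
  let IJ := tensor_ideal iA iB I J in
  min_symbolic_power IJ s x -> Min I p -> Min J q ->
  regular_mod [set u | ideal_pow IJ s (u * x)]
              (tensor_ideal iA iB (prime_set p) (prime_set q)).
Proof.
move=> IJ /symbolic_powerP Tx minp minq z Uz; apply: contrapT => nTz.
have hp := prime_setI p; have hq := prime_setI q.
have hT := is_ideal_tensor iA iB (prime_set p) (prime_set q).
have [Q [t [QE UQ]]] := prime_above_colon noethR hT nTz.
have pqQ : tensor_ideal iA iB (prime_set p) (prime_set q) `<=` prime_set Q.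
  by move=> y Ty; rewrite QE; apply: idealM_r.
have minQ : Min IJ Q.
  split; first by apply: subset_trans pqQ; apply: tensor_idealS; [case: minp | case: minq].
  move=> P IJP PQ; apply/seteqP; split=> //.
  apply: (tensor_unmixed tensorR QE) => //.
  apply: tensor_ideal_sub; first exact: prime_setI.
    apply: (prime_contract_sub minp _ QE IJP PQ) => a y.
    exact: (tensor_prime_regular tensorR hq).
  rewrite /IJ tensor_idealC in IJP.
  apply: (prime_contract_sub minq _ QE IJP PQ) => b y.
  by rewrite tensor_idealC; apply: (tensor_prime_regular (tensor_productC tensorR) hp).
have [u Qu Uu] := Tx Q minQ.
by apply/Qu/UQ/Uz.
Qed.


Theorem theorem4p1 (k : fieldType) (A B R : comAlgType k)
  (iA : {lrmorphism A -> R}) (iB : {lrmorphism B -> R})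
  (tensorR : is_tensor_product iA iB)
  (noethA : noetherian A) (noethB : noetherian B) (noethR : noetherian R)
  (I : set A) (J : set B)
  (idealI : is_ideal I) (idealJ : is_ideal J)
  (I_neq0 : I <> [set 0]) (J_neq0 : J <> [set 0])
  (I_proper : I <> setT) (J_proper : J <> setT)
  (s : nat) (s_ge1 : (1 <= s)%N) :
  let IJ : set R := ideal_add (ideal_ext iA I) (ideal_ext iB J) in
  min_symbolic_power IJ s =
    \big[@ideal_add R/[set 0]]_(i < s.+1)
      ideal_mul (ideal_ext iA (min_symbolic_power I i))
                (ideal_ext iB (min_symbolic_power J (s - i)%N)) /\
  ass_symbolic_power IJ s =
    \big[@ideal_add R/[set 0]]_(i < s.+1)
      ideal_mul (ideal_ext iA (ass_symbolic_power I i))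
                (ideal_ext iB (ass_symbolic_power J (s - i)%N)).
Proof.
move=> IJ.
have tensorC := tensor_productC tensorR.
have IJE : IJ = tensor_ideal iA iB I J by [].
have IJC : IJ = tensor_ideal iB iA J I by rewrite IJE tensor_idealC.
split; apply/seteqP; split.
- move=> x Ix; apply: (symbolic_sum_sub tensorR) => // [p q minp minq|u Uu].
    exact: (min_symbolic_regular tensorR noethR Ix).
  exact: Uu.
- apply: symbolic_sum_sup => P i x minP.
    by apply: min_symbolic_contract minP.
  by rewrite -/IJ IJC in minP; apply: min_symbolic_contract minP.
- move=> x Ix; apply: (symbolic_sum_sub tensorR) => // [p q assp assq|u Uu].
    exact: (ass_symbolic_regular tensorR noethR idealI idealJ Ix).
  exact: Uu.
- apply: symbolic_sum_sup => P i x assP.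
    by apply: ass_symbolic_contract assP.
  by rewrite -/IJ IJC in assP; apply: ass_symbolic_contract assP.
Qed.
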